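(* Let $\Pi$ be a mini-gringo program and let $I$ be a set of precomputed atoms (finite or infinite). Then $I$ is a stable model of $\Pi$ if and only if there exists an interpretation $J$ of the signature $\sigma_0^{lvl}$ whose reduct to $\sigma_0$ (obtained by forgetting the interpretations of the functions $\mathrm{lvl}_p$) equals $I^{\sigma_0}$ and such that $J$ is a model of $\mathrm{NC}(\Pi)$.
   Context: Mini-gringo syntax. Fix countably infinite sets of numerals, symbolic constants and program variables, and a bijection $n\mapsto\overline{n}$ from integers to numerals. Program terms: numerals, symbolic constants, program variables, $\mathit{inf}$, $\mathit{sup}$; $|t|$; $(t_1\circ t_2)$ for $\circ\in\{+,-,\times,/,\backslash,..\}$. Ground = variable-free; precomputed = ground without operation symbols. Precomputed terms are totally ordered with $\mathit{inf}$ least, $\mathit{sup}$ greatest, $\overline m<\overline n$ iff $m<n$. An atom is $p(\mathbf t)$ ($p$ a symbolic constant); a literal is an atom preceded by zero, one or two $\mathit{not}$; a comparison is $t_1\prec t_2$, $\prec\in\{=,\neq,<,>,\le,\ge\}$. A rule is $\mathit{Head}\leftarrow\mathit{Body}$ with $\mathit{Body}$ a possibly empty conjunction of literals and comparisons and $\mathit{Head}$ an atom $p(\mathbf t)$ (basic rule), $\{p(\mathbf t)\}$ (choice rule) or empty (constraint). A program is a finite set of rules, each predicate having a single arity; $\mathcal L(\Pi)$ is its set of predicates. For a rule $R$, $\mathrm{Body}(R)$ is its body, $B^+(R)$ the set of un-negated atoms in its body, $\mathrm{HeadLit}(R)=p(\mathbf t)$ if the head is $p(\mathbf t)$ or $\{p(\mathbf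 t)\}$. An instance of a rule replaces all variables by precomputed terms. Values and $\tau$. For ground $t$, $\mathrm{vals}(t)$ is: $\{t\}$ for numerals, symbolic constants, $\mathit{inf}$, $\mathit{sup}$; for $|t_1|$ the numerals $\overline{|n|}$, $\overline n\in\mathrm{vals}(t_1)$; for $t_1\circ t_2$ ($\circ\in\{+,-,\times\}$) the $\overline{n_1\circ n_2}$ with $\overline{n_i}\in\mathrm{vals}(t_i)$; for $t_1/t_2$ the $\overline{\mathrm{rd}(n_1/n_2)}$ and for $t_1\backslash t_2$ the $\overline{n_1-n_2\mathrm{rd}(n_1/n_2)}$ ($n_2\neq0$), where $\mathrm{rd}$ rounds toward zero; for $t_1..t_2$ the $\overline m$ with $n_1\le m\le n_2$; tuples componentwise. $\tau(p(\mathbf t))=\bigvee_{\mathbf r\in\mathrm{vals}(\mathbf t)}p(\mathbf r)$, $\tau(\mathit{not}\,p(\mathbf t))=\bigvee\neg p(\mathbf r)$, $\tau(\mathit{not}\,\mathit{not}\,p(\mathbf t))=\bigvee\neg\neg p(\mathbf r)$; $\tau(t_1\prec t_2)=\top$ if $r_1\prec r_2$ for some $r_i\in\mathrm{vals}(t_i)$, else $\bot$; conjunctions componentwise. Ground basic rule: $\tau(\mathit{Body})\to\bigwedge_{\mathbf r}p(\mathbf r)$; choice rule: $\tau(\mathit{Body})\to\bigwedge_{\mathbf r}(p(\mathbf r)\vee\neg p(\mathbf r))$; constraint: $\neg\tau(\mathit{Body})$. $\tau(\Pi)=\{\tau(R):R$ an instance of a rule of $\Pi\}$. With $\neg F:=F\to\bot$,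 the reduct $F^I$ of a propositional formula w.r.t. a set $I$ of precomputed atoms is $\bot$ if $I\not\models F$, $p$ if $F$ is an atom $p\in I$, and $G^I\otimes H^I$ if $F=G\otimes H$ ($\otimes\in\{\wedge,\vee,\to\}$) and $I\models F$. $I$ is a stable model of $\Pi$ iff $I$ is the $\subseteq$-minimal model of $\{F^I:F\in\tau(\Pi)\}$. Two-sorted logic. Signature $\sigma_0$: sort general with subsort integer; all precomputed terms as object constants (numerals of sort integer); $|\cdot|$, $+,-,\times$ as integer functions; each program predicate $p/n$ with general arguments; comparisons $=,\neq,\le,\ge,<,>$ on general. Program variables range over general, integer variables over integer. A standard interpretation has general domain the precomputed terms, integer domain the numerals, every object constant denoting itself, arithmetic as usual and comparisons according to the total order. For a set $I$ of precomputed atoms, $I^{\sigma_0}$ is the standard interpretation in which a precomputed atom is true iff it is in $I$. Formula $\mathrm{val}_t(V)$: $V=t$ if $t$ precomputed or a variable; $\exists I(\mathrm{val}_{t_1}(I)\wedge V=|I|)$ for $|t_1|$; $\exists I,J(\mathrm{val}_{t_1}(I)\wedge\mathrm{val}_{t_2}(J)\wedge V=I\circ J)$ for $\circ\in\{+,-,\times\}$; for $t_1/t_2$: $\exists I,J,K(\mathrm{val}_{t_1}(I)\wedge\mathrm{val}_{t_2}(J)\wedge K\times|J|\le|I|<(K+\overline1)\times|J|\wedge((I\times J\ge\overline0\wedge V=K)\vee(I\times J<\overline0\wedge V=-K)))$; for $t_1\backslash t_2$ the same with $V=I-K\times J$ and $V=I+K\times J$ in the two disjuncts; for $t_1..t_2$: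 $\exists I,J,K(\mathrm{val}_{t_1}(I)\wedge\mathrm{val}_{t_2}(J)\wedge I\le K\le J\wedge V=K)$; $I,J,K$ fresh integer variables; for tuples, the conjunction. $\tau^B(p(\mathbf t))=\exists\mathbf V(\mathrm{val}_{\mathbf t}(\mathbf V)\wedge p(\mathbf V))$, similarly with $\neg p(\mathbf V)$, $\neg\neg p(\mathbf V)$ for $\mathit{not}\,p(\mathbf t)$, $\mathit{not}\,\mathit{not}\,p(\mathbf t)$; $\tau^B(t_1\prec t_2)=\exists V_1V_2(\mathrm{val}_{t_1}(V_1)\wedge\mathrm{val}_{t_2}(V_2)\wedge V_1\prec V_2)$; conjunctions componentwise. For a basic or choice rule $R$ with head atom $p(\mathbf t)$ and fresh $\mathbf X$: $\mathrm{Form}(R,\mathbf X)=\mathrm{val}_{\mathbf t}(\mathbf X)\wedge\tau^B(\mathrm{Body}(R))$ for basic rules, additionally $\wedge\neg\neg p(\mathbf X)$ for choice rules. Ordered completion with level mapping. For each predicate $p/n$ introduce a new $n$-ary function $\mathrm{lvl}_p$ (general arguments) with integer values; $\sigma_0^{lvl}$ is $\sigma_0$ extended by these. For $p\in\mathcal L(\Pi)$, with $\mathbf X,\mathbf Z$ fresh program variables of the arities of $p,q$ and $\mathbf Y$ the free variables of $\mathrm{Form}(R,\mathbf X)$ other than $\mathbf X$: $\mathrm{Comp}^{\leftarrow}(p)=\forall\mathbf X\big(\bigvee_{R\in\Pi,\mathrm{HeadLit}(R)=p(\mathbf t)}\exists\mathbf Y\,\mathrm{Form}(R,\mathbf X)\to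 p(\mathbf X)\big)$, $\mathrm{NComp}^{\to}(p)=\forall\mathbf X\big(p(\mathbf X)\to\bigvee_{R\in\Pi,\mathrm{HeadLit}(R)=p(\mathbf t)}\exists\mathbf Y(\mathrm{Form}(R,\mathbf X)\wedge\bigwedge_{q(\mathbf t')\in B^+(R)}\exists\mathbf Z(\mathrm{val}_{\mathbf t'}(\mathbf Z)\wedge q(\mathbf Z)\wedge\mathrm{lvl}_q(\mathbf Z)<\mathrm{lvl}_p(\mathbf X)))\big)$. $\mathrm{Cons}(\Pi)=\bigwedge_{R\text{ constraint in }\Pi}\forall\mathbf U\,\neg\tau^B(\mathrm{Body}(R))$. $\mathrm{Nat}(\Pi)=\bigwedge_{p\in\mathcal L(\Pi)}\forall\mathbf X(\mathrm{lvl}_p(\mathbf X)\ge\overline0)$. $\mathrm{NC}(\Pi)=\mathrm{Nat}(\Pi)\wedge\mathrm{Cons}(\Pi)\wedge\bigwedge_{p\in\mathcal L(\Pi)}(\mathrm{Comp}^{\leftarrow}(p)\wedge\mathrm{NComp}^{\to}(p))$.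
   Formalization: The set I is required to contain only precomputed atoms whose predicate p/n belongs to the program; without this the claim fails, e.g. for the empty program and I = {q}, which is not stable although NC is a tautology. *)

(* Defs.v *)
(* Stdlib only; integers are Z. *)
From Stdlib Require Import ZArith List String Bool ClassicalEpsilon.
Import ListNotations.

Set Implicit Arguments.

(** * Syntax of mini-gringo *)

Definition symbol := string.
Definition variable := string.

(* [overline] is the bijection from integers to numerals. *)
Record numeral := overline { int_of : Z }.

Inductive precomputed :=
| Inf
| Sup
| Num (c : numeral)
| Sym (s : symbol).

Inductive binop := Add | Sub | Mul | Div | Mod | Interval.

Inductive comparison := Eq | Ne | Lt | Gt | Le | Ge.

(* Terms with variables from V.  Program terms have V = variable; ground terms
   have V = Empty_set. *)
Inductive term (V : Type) :=
| TPre (r : precomputed)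
| TVar (x : V)
| TAbs (t : term V)
| TBin (o : binop) (t1 t2 : term V).
Arguments TPre {V} r.

(* The predicate p/n of the atom p(t_1,...,t_n) is the pair (p, n). *)
Definition predicate := (symbol * nat)%type.

Record atom (V : Type) := Atom { atom_sym : symbol; atom_args : list (term V) }.

Definition atom_pred V (a : atom V) : predicate :=
  (atom_sym a, List.length (atom_args a)).

Inductive negation := NoNot | Not | NotNot.

Inductive body_elem (V : Type) :=
| BLit (s : negation) (a : atom V)
| BCmp (c : comparison) (t1 t2 : term V).
Arguments BCmp {V} c t1 t2.

Inductive head_expr (V : Type) :=
| HBasic (a : atom V)
| HChoice (a : atom V)
| HEmpty.
Arguments HEmpty {V}.

Record rule (V : Type) := Rule { head : head_expr V; body : list (body_elem V) }.

Definition head_lit V (R : rule V) : option (atom V) :=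
  match head R with
  | HBasic a | HChoice a => Some a
  | HEmpty => None
  end.

Definition positive_body V (R : rule V) : list (atom V) :=
  flat_map (fun e => match e with BLit NoNot a => [a] | _ => [] end) (body R).

Definition rule_preds V (R : rule V) : list predicate :=
  (match head_lit R with Some a => [atom_pred a] | None => [] end)
  ++ flat_map (fun e => match e with BLit _ a => [atom_pred a] | _ => [] end)
       (body R).

Definition rules_preds V (Rs : list (rule V)) : list predicate :=
  flat_map (@rule_preds V) Rs.

Record program := Program {
  rules : list (rule variable);
  single_arity : forall p n m,
    In (p, n) (rules_preds rules) -> In (p, m) (rules_preds rules) -> n = m }.

(* L(Pi) *)
Definition preds (Pi : program) : list predicate := rules_preds (rules Pi).

(** Instances *)

Definition ground := Empty_set.

Fixpoint subst_term V (s : V -> precomputed) (t : term V) : term ground :=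
  match t with
  | TPre r => TPre r
  | TVar x => TPre (s x)
  | TAbs t1 => TAbs (subst_term s t1)
  | TBin o t1 t2 => TBin o (subst_term s t1) (subst_term s t2)
  end.

Definition subst_atom V (s : V -> precomputed) (a : atom V) : atom ground :=
  Atom (atom_sym a) (map (subst_term s) (atom_args a)).

Definition subst_body_elem V (s : V -> precomputed) (e : body_elem V) :
  body_elem ground :=
  match e with
  | BLit n a => BLit n (subst_atom s a)
  | BCmp c t1 t2 => BCmp c (subst_term s t1) (subst_term s t2)
  end.

Definition subst_head V (s : V -> precomputed) (h : head_expr V) :
  head_expr ground :=
  match h with
  | HBasic a => HBasic (subst_atom s a)
  | HChoice a => HChoice (subst_atom s a)
  | HEmpty => HEmpty
  end.

Definition subst_rule V (s : V -> precomputed) (R : rule V) : rule ground :=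
  Rule (subst_head s (head R)) (map (subst_body_elem s) (body R)).

(** * The order on precomputed terms

    How symbolic constants compare with one another and with numerals is not
    prescribed, so the order is a parameter. *)

Record term_order := {
  tle : precomputed -> precomputed -> Prop;
  tle_refl : forall r, tle r r;
  tle_antisym : forall r1 r2, tle r1 r2 -> tle r2 r1 -> r1 = r2;
  tle_trans : forall r1 r2 r3, tle r1 r2 -> tle r2 r3 -> tle r1 r3;
  tle_total : forall r1 r2, tle r1 r2 \/ tle r2 r1;
  tle_inf : forall r, tle Inf r;
  tle_sup : forall r, tle r Sup;
  tlt_num : forall m n : Z,
    (tle (Num (overline m)) (Num (overline n)) /\
     Num (overline m) <> Num (overline n)) <-> (m < n)%Z }.

Definition tlt (ord : term_order) (r1 r2 : precomputed) : Prop :=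
  tle ord r1 r2 /\ r1 <> r2.

Definition compare (ord : term_order) (c : comparison) (r1 r2 : precomputed) :
  Prop :=
  match c with
  | Eq => r1 = r2
  | Ne => r1 <> r2
  | Lt => tlt ord r1 r2
  | Gt => tlt ord r2 r1
  | Le => tle ord r1 r2
  | Ge => tle ord r2 r1
  end.

(** * Values of ground terms

    vals(t) is finite and is represented by a list of its elements. *)

Definition num (n : Z) : precomputed := Num (overline n).

Definition integers_in (l : list precomputed) : list Z :=
  flat_map (fun r => match r with Num c => [int_of c] | _ => [] end) l.

(* Z.quot rounds toward zero. *)
Definition binop_vals (o : binop) (n1 n2 : Z) : list Z :=
  match o with
  | Add => [(n1 + n2)%Z]
  | Sub => [(n1 - n2)%Z]
  | Mul => [(n1 * n2)%Z]
  | Div => if (n2 =? 0)%Z then [] else [Z.quot n1 n2]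
  | Mod => if (n2 =? 0)%Z then [] else [(n1 - n2 * Z.quot n1 n2)%Z]
  | Interval =>
      map (fun k => (n1 + Z.of_nat k)%Z) (seq 0 (Z.to_nat (n2 - n1 + 1)))
  end.

Fixpoint vals (t : term ground) : list precomputed :=
  match t with
  | TPre r => [r]
  | TVar x => match x with end
  | TAbs t1 => map (fun n => num (Z.abs n)) (integers_in (vals t1))
  | TBin o t1 t2 =>
      flat_map (fun n1 =>
        flat_map (fun n2 => map num (binop_vals o n1 n2))
          (integers_in (vals t2)))
        (integers_in (vals t1))
  end.

Fixpoint vals_tuple (ts : list (term ground)) : list (list precomputed) :=
  match ts with
  | [] => [[]]
  | t :: ts' => flat_map (fun r => map (cons r) (vals_tuple ts')) (vals t)
  end.

(** * Propositional formulas, reducts, stable models *)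

Record precomputed_atom := PAtom {
  patom_sym : symbol;
  patom_args : list precomputed }.

Definition patom_pred (a : precomputed_atom) : predicate :=
  (patom_sym a, List.length (patom_args a)).

Definition atom_set := precomputed_atom -> Prop.

Inductive pform :=
| PAt (a : precomputed_atom)
| PBot
| PAnd (F G : pform)
| POr (F G : pform)
| PImp (F G : pform).

Definition PNeg (F : pform) : pform := PImp F PBot.
Definition PTop : pform := PNeg PBot.
Definition PConj (l : list pform) : pform := fold_right PAnd PTop l.
Definition PDisj (l : list pform) : pform := fold_right POr PBot l.

Fixpoint psat (I : atom_set) (F : pform) : Prop :=
  match F with
  | PAt a => I a
  | PBot => False
  | PAnd G H => psat I G /\ psat I H
  | POr G H => psat I G \/ psat I H
  | PImp G H => psat I G -> psat I H
  end.

Fixpoint preduct (I : atom_set) (F : pform) : pform :=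
  if excluded_middle_informative (psat I F) then
    match F with
    | PAt a => PAt a
    | PBot => PBot
    | PAnd G H => PAnd (preduct I G) (preduct I H)
    | POr G H => POr (preduct I G) (preduct I H)
    | PImp G H => PImp (preduct I G) (preduct I H)
    end
  else PBot.

Section Tau.

Variable ord : term_order.

Definition atoms_of (a : atom ground) : list pform :=
  map (fun rs => PAt (PAtom (atom_sym a) rs)) (vals_tuple (atom_args a)).

Definition tau_body_elem (e : body_elem ground) : pform :=
  match e with
  | BLit NoNot a => PDisj (atoms_of a)
  | BLit Not a => PDisj (map PNeg (atoms_of a))
  | BLit NotNot a => PDisj (map (fun F => PNeg (PNeg F)) (atoms_of a))
  | BCmp c t1 t2 =>
      if excluded_middle_informative
           (exists r1 r2, In r1 (vals t1) /\ In r2 (vals t2) /\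
                          compare ord c r1 r2)
      then PTop else PBot
  end.

Definition tau_body (b : list (body_elem ground)) : pform :=
  PConj (map tau_body_elem b).

Definition tau_rule (R : rule ground) : pform :=
  match head R with
  | HBasic a => PImp (tau_body (body R)) (PConj (atoms_of a))
  | HChoice a =>
      PImp (tau_body (body R))
        (PConj (map (fun F => POr F (PNeg F)) (atoms_of a)))
  | HEmpty => PNeg (tau_body (body R))
  end.

Definition tau (Pi : program) (F : pform) : Prop :=
  exists R s, In R (rules Pi) /\ F = tau_rule (subst_rule s R).

Definition reduct_model (Pi : program) (I I' : atom_set) : Prop :=
  forall F, tau Pi F -> psat I' (preduct I F).

Definition stable_model (Pi : program) (I : atom_set) : Prop :=
  reduct_model Pi I I /\
  forall I' : atom_set,
    (forall a, I' a -> I a) -> reduct_model Pi I I' -> forall a, I a -> I' a.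

End Tau.

(** * The two-sorted language of the signature extended with level functions

    The general variables are the program variables together with three
    reserves of variables [FreshV], [FreshX], [FreshZ] that occur in no
    program.  The integer variables [VarI d], [VarJ d], [VarK d] are indexed
    by the nesting depth at which the formula val introduces them. *)

Inductive gvar :=
| ProgVar (x : variable)
| FreshV (i : nat)
| FreshX (i : nat)
| FreshZ (i : nat).

Inductive ivar :=
| VarI (d : nat)
| VarJ (d : nat)
| VarK (d : nat).

Inductive var :=
| GenVar (x : gvar)
| IntVar (x : ivar).

Definition gvar_eq_dec (x y : gvar) : {x = y} + {x <> y}.
Proof. decide equality; (apply string_dec || apply Nat.eq_dec). Defined.

Definition ivar_eq_dec (x y : ivar) : {x = y} + {x <> y}.
Proof. decide equality; apply Nat.eq_dec. Defined.

Definition var_eq_dec (x y : var) : {x = y} + {x <> y}.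
Proof. decide equality; (apply gvar_eq_dec || apply ivar_eq_dec). Defined.

Arguments gvar_eq_dec : simpl never.
Arguments ivar_eq_dec : simpl never.
Arguments var_eq_dec : simpl never.

(* [GInt] makes integer a subsort of general.  The level function of p/n is
   [ILvl p] applied to lists of length n. *)
Inductive iterm :=
| INum (c : numeral)
| IVar (x : ivar)
| IAbs (t : iterm)
| IAdd (t1 t2 : iterm)
| ISub (t1 t2 : iterm)
| IMul (t1 t2 : iterm)
| ILvl (p : symbol) (ts : list gterm)
with gterm :=
| GInf
| GSup
| GSym (s : symbol)
| GVar (x : gvar)
| GInt (t : iterm).

Inductive form :=
| FPred (p : symbol) (ts : list gterm)
| FCmp (c : comparison) (t1 t2 : gterm)
| FBot
| FAnd (F G : form)
| FOr (F G : form)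
| FImp (F G : form)
| FAll (x : var) (F : form)
| FEx (x : var) (F : form).

Definition FNeg (F : form) : form := FImp F FBot.
Definition FTop : form := FNeg FBot.
Definition FConj (l : list form) : form := fold_right FAnd FTop l.
Definition FDisj (l : list form) : form := fold_right FOr FBot l.
Definition FAlls (xs : list var) (F : form) : form := fold_right FAll F xs.
Definition FExs (xs : list var) (F : form) : form := fold_right FEx F xs.

Fixpoint fv_iterm (t : iterm) : list var :=
  match t with
  | INum _ => []
  | IVar x => [IntVar x]
  | IAbs t1 => fv_iterm t1
  | IAdd t1 t2 | ISub t1 t2 | IMul t1 t2 => fv_iterm t1 ++ fv_iterm t2
  | ILvl _ ts => flat_map fv_gterm ts
  end
with fv_gterm (t : gterm) : list var :=
  match t with
  | GInf | GSup | GSym _ => []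
  | GVar x => [GenVar x]
  | GInt t1 => fv_iterm t1
  end.

Fixpoint fv (F : form) : list var :=
  match F with
  | FPred _ ts => flat_map fv_gterm ts
  | FCmp _ t1 t2 => fv_gterm t1 ++ fv_gterm t2
  | FBot => []
  | FAnd G H | FOr G H | FImp G H => fv G ++ fv H
  | FAll x G | FEx x G => remove var_eq_dec x (fv G)
  end.

Definition fv_except (xs : list var) (F : form) : list var :=
  filter (fun y => if in_dec var_eq_dec y xs then false else true) (fv F).

(** * Interpretations *)

(* Interpretations of sigma_0.  [int_incl] is the inclusion of the integer
   domain in the general domain; the value of the predicate constant p/n is
   [pred_i p] on lists of length n. *)
Record interp := {
  gen_dom : Type;
  int_dom : Type;
  int_incl : int_dom -> gen_dom;
  int_incl_inj : forall x y, int_incl x = int_incl y -> x = y;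
  num_i : numeral -> int_dom;
  inf_i : gen_dom;
  sup_i : gen_dom;
  sym_i : symbol -> gen_dom;
  abs_i : int_dom -> int_dom;
  add_i : int_dom -> int_dom -> int_dom;
  sub_i : int_dom -> int_dom -> int_dom;
  mul_i : int_dom -> int_dom -> int_dom;
  pred_i : symbol -> list gen_dom -> Prop;
  cmp_i : comparison -> gen_dom -> gen_dom -> Prop }.

(* Interpretations of sigma_0^lvl; [reduct] forgets the level functions. *)
Record interp_lvl := {
  reduct : interp;
  lvl_i : symbol -> list (gen_dom reduct) -> int_dom reduct }.

Lemma Num_inj (c d : numeral) : Num c = Num d -> c = d.
Proof. congruence. Qed.

Definition lift1 (f : Z -> Z) (c : numeral) : numeral :=
  overline (f (int_of c)).
Definition lift2 (f : Z -> Z -> Z) (c d : numeral) : numeral :=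
  overline (f (int_of c) (int_of d)).

(* I^{sigma_0} *)
Definition standard (ord : term_order) (I : atom_set) : interp := {|
  gen_dom := precomputed;
  int_dom := numeral;
  int_incl := Num;
  int_incl_inj := Num_inj;
  num_i := fun c => c;
  inf_i := Inf;
  sup_i := Sup;
  sym_i := Sym;
  abs_i := lift1 Z.abs;
  add_i := lift2 Z.add;
  sub_i := lift2 Z.sub;
  mul_i := lift2 Z.mul;
  pred_i := fun p rs => I (PAtom p rs);
  cmp_i := compare ord |}.

Section Satisfaction.

Variable J : interp_lvl.

Record assignment := {
  gen_val : gvar -> gen_dom (reduct J);
  int_val : ivar -> int_dom (reduct J) }.

Definition upd_gen (e : assignment) (x : gvar) (d : gen_dom (reduct J)) :
  assignment :=
  {| gen_val := fun y => if gvar_eq_dec y x then d else gen_val e y;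
     int_val := int_val e |}.

Definition upd_int (e : assignment) (x : ivar) (d : int_dom (reduct J)) :
  assignment :=
  {| gen_val := gen_val e;
     int_val := fun y => if ivar_eq_dec y x then d else int_val e y |}.

Fixpoint ieval (e : assignment) (t : iterm) : int_dom (reduct J) :=
  match t with
  | INum c => num_i (reduct J) c
  | IVar x => int_val e x
  | IAbs t1 => abs_i (reduct J) (ieval e t1)
  | IAdd t1 t2 => add_i (reduct J) (ieval e t1) (ieval e t2)
  | ISub t1 t2 => sub_i (reduct J) (ieval e t1) (ieval e t2)
  | IMul t1 t2 => mul_i (reduct J) (ieval e t1) (ieval e t2)
  | ILvl p ts => lvl_i J p (map (geval e) ts)
  end
with geval (e : assignment) (t : gterm) : gen_dom (reduct J) :=
  match t with
  | GInf => inf_i (reduct J)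
  | GSup => sup_i (reduct J)
  | GSym s => sym_i (reduct J) s
  | GVar x => gen_val e x
  | GInt t1 => int_incl (reduct J) (ieval e t1)
  end.

Fixpoint sat (e : assignment) (F : form) : Prop :=
  match F with
  | FPred p ts => pred_i (reduct J) p (map (geval e) ts)
  | FCmp c t1 t2 => cmp_i (reduct J) c (geval e t1) (geval e t2)
  | FBot => False
  | FAnd G H => sat e G /\ sat e H
  | FOr G H => sat e G \/ sat e H
  | FImp G H => sat e G -> sat e H
  | FAll (GenVar x) G => forall d, sat (upd_gen e x d) G
  | FAll (IntVar x) G => forall d, sat (upd_int e x d) G
  | FEx (GenVar x) G => exists d, sat (upd_gen e x d) G
  | FEx (IntVar x) G => exists d, sat (upd_int e x d) G
  end.

Definition model (F : form) : Prop := forall e, sat e F.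

End Satisfaction.

(** * The formulas val and tau^B *)

Definition gconst (r : precomputed) : gterm :=
  match r with
  | Inf => GInf
  | Sup => GSup
  | Num c => GInt (INum c)
  | Sym s => GSym s
  end.

Definition ICmp (c : comparison) (t1 t2 : iterm) : form :=
  FCmp c (GInt t1) (GInt t2).

Definition IZ (n : Z) : iterm := INum (overline n).

(* K * |J| <= |I| < (K + 1) * |J| *)
Definition quotient_form (I J K : iterm) : form :=
  FAnd (ICmp Le (IMul K (IAbs J)) (IAbs I))
       (ICmp Lt (IAbs I) (IMul (IAdd K (IZ 1)) (IAbs J))).

(* (I * J >= 0 /\ V = T1) \/ (I * J < 0 /\ V = T2) *)
Definition by_sign (I J : iterm) (V : gterm) (T1 T2 : iterm) : form :=
  FOr (FAnd (ICmp Ge (IMul I J) (IZ 0)) (FCmp Eq V (GInt T1)))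
      (FAnd (ICmp Lt (IMul I J) (IZ 0)) (FCmp Eq V (GInt T2))).

(* Unary minus is not in the signature: -K is 0 - K. *)
Definition binop_form (o : binop) (d : nat) (V : gterm) (F1 F2 : form) : form :=
  let vI := IntVar (VarI d) in
  let vJ := IntVar (VarJ d) in
  let vK := IntVar (VarK d) in
  let I := IVar (VarI d) in
  let J := IVar (VarJ d) in
  let K := IVar (VarK d) in
  match o with
  | Add => FExs [vI; vJ] (FConj [F1; F2; FCmp Eq V (GInt (IAdd I J))])
  | Sub => FExs [vI; vJ] (FConj [F1; F2; FCmp Eq V (GInt (ISub I J))])
  | Mul => FExs [vI; vJ] (FConj [F1; F2; FCmp Eq V (GInt (IMul I J))])
  | Div =>
      FExs [vI; vJ; vK]
        (FConj [F1; F2; quotient_form I J K;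
                by_sign I J V K (ISub (IZ 0) K)])
  | Mod =>
      FExs [vI; vJ; vK]
        (FConj [F1; F2; quotient_form I J K;
                by_sign I J V (ISub I (IMul K J)) (IAdd I (IMul K J))])
  | Interval =>
      FExs [vI; vJ; vK]
        (FConj [F1; F2; FAnd (ICmp Le I K) (ICmp Le K J);
                FCmp Eq V (GInt K)])
  end.

(* The integer variables bound in [val d t V] have index at least d. *)
Fixpoint val (d : nat) (t : term variable) (V : gterm) : form :=
  match t with
  | TPre r => FCmp Eq V (gconst r)
  | TVar x => FCmp Eq V (GVar (ProgVar x))
  | TAbs t1 =>
      FEx (IntVar (VarI d))
        (FAnd (val (S d) t1 (GInt (IVar (VarI d))))
              (FCmp Eq V (GInt (IAbs (IVar (VarI d))))))
  | TBin o t1 t2 =>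
      binop_form o d V
        (val (S d) t1 (GInt (IVar (VarI d))))
        (val (S d) t2 (GInt (IVar (VarJ d))))
  end.

Definition gvars (xs : list gvar) : list gterm := map GVar xs.

Definition val_tuple (ts : list (term variable)) (Vs : list gvar) : form :=
  FConj (map (fun tV => val 0 (fst tV) (GVar (snd tV))) (combine ts Vs)).

Definition fresh_tuple (f : nat -> gvar) (n : nat) : list gvar :=
  map f (seq 0 n).

Definition tauB_elem (e : body_elem variable) : form :=
  match e with
  | BLit s a =>
      let Vs := fresh_tuple FreshV (List.length (atom_args a)) in
      let F := FPred (atom_sym a) (gvars Vs) in
      FExs (map GenVar Vs)
        (FAnd (val_tuple (atom_args a) Vs)
              match s with
              | NoNot => F
              | Not => FNeg F
              | NotNot => FNeg (FNeg F)
              end)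
  | BCmp c t1 t2 =>
      FExs [GenVar (FreshV 0); GenVar (FreshV 1)]
        (FConj [val 0 t1 (GVar (FreshV 0)); val 0 t2 (GVar (FreshV 1));
                FCmp c (GVar (FreshV 0)) (GVar (FreshV 1))])
  end.

Definition tauB (b : list (body_elem variable)) : form :=
  FConj (map tauB_elem b).

(** * Ordered completion with level mapping *)

(* Not used for constraints. *)
Definition Form (R : rule variable) (Xs : list gvar) : form :=
  match head R with
  | HBasic a => FAnd (val_tuple (atom_args a) Xs) (tauB (body R))
  | HChoice a =>
      FConj [val_tuple (atom_args a) Xs; tauB (body R);
             FNeg (FNeg (FPred (atom_sym a) (gvars Xs)))]
  | HEmpty => FBot
  end.

Definition predicate_eq_dec (p q : predicate) : {p = q} + {p <> q}.
Proof. decide equality; (apply string_dec || apply Nat.eq_dec). Defined.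

Arguments predicate_eq_dec : simpl never.

Definition rules_for (Pi : program) (p : predicate) : list (rule variable) :=
  filter (fun R =>
    match head_lit R with
    | Some a => if predicate_eq_dec (atom_pred a) p then true else false
    | None => false
    end) (rules Pi).

Definition constraints (Pi : program) : list (rule variable) :=
  filter (fun R => match head R with HEmpty => true | _ => false end)
    (rules Pi).

Definition head_vars (p : predicate) : list gvar := fresh_tuple FreshX (snd p).

(* Y *)
Definition local_vars (R : rule variable) (Xs : list gvar) : list var :=
  fv_except (map GenVar Xs) (Form R Xs).

Definition CompL (Pi : program) (p : predicate) : form :=
  let Xs := head_vars p in
  FAlls (map GenVar Xs)
    (FImp
       (FDisj (map (fun R => FExs (local_vars R Xs) (Form R Xs))
                 (rules_for Pi p)))
       (FPred (fst p) (gvars Xs))).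

Definition lower_level (p : predicate) (Xs : list gvar) (b : atom variable) :
  form :=
  let Zs := fresh_tuple FreshZ (List.length (atom_args b)) in
  FExs (map GenVar Zs)
    (FConj [val_tuple (atom_args b) Zs;
            FPred (atom_sym b) (gvars Zs);
            ICmp Lt (ILvl (atom_sym b) (gvars Zs)) (ILvl (fst p) (gvars Xs))]).

Definition NCompR (Pi : program) (p : predicate) : form :=
  let Xs := head_vars p in
  FAlls (map GenVar Xs)
    (FImp
       (FPred (fst p) (gvars Xs))
       (FDisj (map (fun R =>
          FExs (local_vars R Xs)
            (FAnd (Form R Xs)
                  (FConj (map (lower_level p Xs) (positive_body R)))))
          (rules_for Pi p)))).

Definition Cons (Pi : program) : form :=
  FConj (map (fun R => FAlls (fv (tauB (body R))) (FNeg (tauB (body R))))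
           (constraints Pi)).

Definition NatLvl (Pi : program) : form :=
  FConj (map (fun p =>
    let Xs := head_vars p in
    FAlls (map GenVar Xs) (ICmp Ge (ILvl (fst p) (gvars Xs)) (IZ 0)))
    (preds Pi)).

Definition NC (Pi : program) : form :=
  FConj [NatLvl Pi; Cons Pi;
         FConj (map (fun p => FAnd (CompL Pi p) (NCompR Pi p)) (preds Pi))].

(** * Sets of atoms over the predicates of a program

    The predicate constants of sigma_0 are the predicates of the program, so
    the precomputed atoms that I^{sigma_0} interprets are those formed from
    them. *)

Definition over_program (Pi : program) (I : atom_set) : Prop :=
  forall a, I a -> In (patom_pred a) (preds Pi).

(* Main.v *)
(** In a standard interpretation [val_t(V)] says that V is a value of t, hence
    [tau^B(Body)] is the truth of [tau(Body)] in I.  For I' included in I, the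
    reduct of [tau(Pi)] with respect to I holds in I' iff I satisfies the
    constraints, is closed under the rules, and every rule instance whose body
    is true in I and whose positive body atoms can be satisfied inside I' has
    its head in I'.  Level mappings then match derivation stages: if I is
    stable, each of its atoms is derived after finitely many rounds, because
    bodies are finite, and the least such round is a level; conversely,
    induction on natural-number levels puts every atom of I into any such
    I'. *)

From Stdlib Require Import ZArith Lia List FinFun ClassicalEpsilon
  FunctionalExtensionality.
Require Import Defs.
Import ListNotations.

Set Implicit Arguments.

(** * Blocks of quantifiers *)

(** Both sides of the equivalence reduce to statements about rule instances, and
    [supported_in K s R] links them because the set [K] is a parameter. For a candidate submodel it
    says when the reduct of a true body holds; for the set of atoms of smaller level it is the extra
    conjunct of [NCompR]; for a stage it defines the next stage. Most of the length goes into
    variables. The formula [val] nests quantifiers over integer variables, so its meaning can be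
    proved by induction only for value terms that these quantifiers cannot capture. An instance
    substitutes for all program variables, while the completion quantifies over the list
    [local_vars] read off a formula; matching the two requires that every variable of a rule occur
    free in its [Form]. The reduct is handled through satisfaction clauses, those of the logic of
    here-and-there with [I] as the upper world. Classical reasoning turns the double negation in
    choice rules into membership in [I]. *)

Section Quantifiers.

Variable J : interp_lvl.

(** A relation instead of iterated updates treats a whole quantifier block at once and is
    insensitive to order and repetition in [ys]; lists obtained from [fv] may contain duplicates. *)
Definition agree_off (ys : list var) (e e' : assignment J) : Prop :=
  (forall x, ~ In (GenVar x) ys -> gen_val e' x = gen_val e x) /\
  (forall x, ~ In (IntVar x) ys -> int_val e' x = int_val e x).

Lemma agree_off_nil e e' : agree_off [] e e' <-> e' = e.
Proof.
  split; [|intros ->; split; reflexivity].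
  destruct e as [g i], e' as [g' i']; intros [Hg Hi]; simpl in *.
  f_equal; apply functional_extensionality; auto.
Qed.

Lemma agree_off_gen x ys e e' :
  agree_off (GenVar x :: ys) e e' <->
  exists d, agree_off ys (upd_gen e x d) e'.
Proof.
  split.
  (* The final value of [x] serves as witness even if [x] occurs again in [ys]. *)
  - intros [Hg Hi]. exists (gen_val e' x); split; simpl; intros y Hy.
    + destruct (gvar_eq_dec y x) as [->|n]; [reflexivity|].
      apply Hg; simpl; intros [E|E]; [congruence|tauto].
    + apply Hi; simpl; intros [E|E]; [congruence|tauto].
  - intros [d [Hg Hi]]; split; simpl in *; intros y Hy.
    + rewrite Hg by tauto. destruct (gvar_eq_dec y x) as [->|n]; tauto.
    + apply Hi; tauto.
Qed.

Lemma agree_off_int x ys e e' :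
  agree_off (IntVar x :: ys) e e' <->
  exists d, agree_off ys (upd_int e x d) e'.
Proof.
  split.
  - intros [Hg Hi]. exists (int_val e' x); split; simpl; intros y Hy.
    + apply Hg; simpl; intros [E|E]; [congruence|tauto].
    + destruct (ivar_eq_dec y x) as [->|n]; [reflexivity|].
      apply Hi; simpl; intros [E|E]; [congruence|tauto].
  - intros [d [Hg Hi]]; split; simpl in *; intros y Hy.
    + apply Hg; tauto.
    + rewrite Hi by tauto. destruct (ivar_eq_dec y x) as [->|n]; tauto.
Qed.

Lemma sat_FExs ys F e :
  sat e (FExs ys F) <-> exists e', agree_off ys e e' /\ sat e' F.
Proof.
  revert e; induction ys as [|[x|x] ys IH]; intros e; simpl.
  - split.
    + intros H; exists e; rewrite agree_off_nil; auto.
    + intros [e' [H1 H2]]; apply agree_off_nil in H1; subst; auto.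
  - split.
    + intros [d H]; apply IH in H; destruct H as [e' [H1 H2]].
      exists e'; rewrite agree_off_gen; eauto.
    + intros [e' [H1 H2]]; apply agree_off_gen in H1; destruct H1 as [d H1].
      exists d; apply IH; eauto.
  - split.
    + intros [d H]; apply IH in H; destruct H as [e' [H1 H2]].
      exists e'; rewrite agree_off_int; eauto.
    + intros [e' [H1 H2]]; apply agree_off_int in H1; destruct H1 as [d H1].
      exists d; apply IH; eauto.
Qed.

Lemma sat_FAlls ys F e :
  sat e (FAlls ys F) <-> forall e', agree_off ys e e' -> sat e' F.
Proof.
  revert e; induction ys as [|[x|x] ys IH]; intros e; simpl.
  - split.
    + intros H e' He; apply agree_off_nil in He; subst; auto.
    + intros H; apply H, agree_off_nil; reflexivity.
  - split.
    + intros H e' He; apply agree_off_gen in He; destruct He as [d He].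
      exact (proj1 (IH _) (H d) _ He).
    + intros H d; apply IH; intros e' He; apply H, agree_off_gen; eauto.
  - split.
    + intros H e' He; apply agree_off_int in He; destruct He as [d He].
      exact (proj1 (IH _) (H d) _ He).
    + intros H d; apply IH; intros e' He; apply H, agree_off_int; eauto.
Qed.

(** Truth in a model ranges over all assignments, so leading universal quantifiers can be stripped
    and the assignment chosen freely, program variables included. *)
Lemma model_FAlls ys F : model J (FAlls ys F) <-> model J F.
Proof.
  split.
  - intros H e; apply (proj1 (sat_FAlls _ _ _) (H e)); split; reflexivity.
  - intros H e; apply sat_FAlls; auto.
Qed.

Lemma sat_FConj l (e : assignment J) : sat e (FConj l) <-> forall F, In F l -> sat e F.
Proof.
  induction l as [|G l IH]; simpl.
  - tauto.
  - rewrite IH; firstorder (subst; auto).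
Qed.

Lemma sat_FDisj l (e : assignment J) : sat e (FDisj l) <-> exists F, In F l /\ sat e F.
Proof.
  induction l as [|G l IH]; simpl.
  - firstorder.
  - rewrite IH; firstorder (subst; auto).
Qed.

Lemma model_FConj l : model J (FConj l) <-> forall F, In F l -> model J F.
Proof.
  unfold model; split.
  - intros H F HF e; exact (proj1 (sat_FConj _ _) (H e) F HF).
  - intros H e; apply sat_FConj; auto.
Qed.

Lemma model_FAnd F G : model J (FAnd F G) <-> model J F /\ model J G.
Proof. unfold model; simpl; firstorder. Qed.

Lemma assign_tuple (e : assignment J) (xs : list gvar) rs :
  NoDup xs -> length xs = length rs ->
  exists e', agree_off (map GenVar xs) e e' /\ map (gen_val e') xs = rs.
Proof.
  intros Hnd; revert e rs; induction Hnd as [|x xs Hx Hnd IH];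
    intros e [|r rs] Hl; simpl in *; try discriminate.
  - exists e; split; [|reflexivity]; apply agree_off_nil; reflexivity.
  - destruct (IH (upd_gen e x r) rs) as [e' [H1 H2]]; [congruence|].
    exists e'; split; [apply agree_off_gen; eauto|].
    rewrite H2; f_equal.
    destruct H1 as [H1 _]; rewrite H1.
    + simpl; destruct (gvar_eq_dec x x); congruence.
    + rewrite in_map_iff; intros [y [E Hy]]; congruence.
Qed.

End Quantifiers.

Lemma fresh_tuple_NoDup f n :
  (forall i j, f i = f j -> i = j) -> NoDup (fresh_tuple f n).
Proof.
  intros Hf; apply Injective_map_NoDup; [exact Hf|apply seq_NoDup].
Qed.

Lemma fresh_tuple_length f n : length (fresh_tuple f n) = n.
Proof. unfold fresh_tuple; rewrite length_map, length_seq; reflexivity. Qed.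

Lemma in_fresh_tuple f n x : In x (fresh_tuple f n) -> exists i, x = f i.
Proof. intros H; apply in_map_iff in H; destruct H as [i [<- _]]; eauto. Qed.

(** * Values of terms *)

Lemma in_integers_in n l : In n (integers_in l) <-> In (num n) l.
Proof.
  unfold integers_in; rewrite in_flat_map; split.
  - intros [[| |[m]|s] [H1 H2]]; simpl in H2; try tauto.
    destruct H2 as [->|[]]; exact H1.
  - intros H; exists (num n); simpl; auto.
Qed.

Lemma in_vals_TAbs r t :
  In r (vals (TAbs t)) <-> exists n, In (num n) (vals t) /\ r = num (Z.abs n).
Proof.
  simpl; rewrite in_map_iff; split.
  - intros [n [<- H]]; rewrite in_integers_in in H; eauto.
  - intros [n [H ->]]; exists n; rewrite in_integers_in; auto.
Qed.

Lemma in_vals_TBin r o t1 t2 :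
  In r (vals (TBin o t1 t2)) <->
  exists n1 n2 k, In (num n1) (vals t1) /\ In (num n2) (vals t2) /\
    In k (binop_vals o n1 n2) /\ r = num k.
Proof.
  simpl; rewrite in_flat_map; split.
  - intros [n1 [H1 H]]; apply in_flat_map in H; destruct H as [n2 [H2 H]].
    apply in_map_iff in H; destruct H as [k [<- H]].
    rewrite in_integers_in in H1, H2; eauto 8.
  - intros (n1 & n2 & k & H1 & H2 & H & ->).
    exists n1; rewrite in_integers_in; split; [exact H1|].
    apply in_flat_map; exists n2; rewrite in_integers_in; split; [exact H2|].
    apply in_map; exact H.
Qed.

Lemma in_binop_vals_Interval k m n :
  In k (binop_vals Interval m n) <-> (m <= k <= n)%Z.
Proof.
  simpl; rewrite in_map_iff; split.
  - intros [i [<- H]]; apply in_seq in H; lia.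
  - intros H; exists (Z.to_nat (k - m)); rewrite in_seq; lia.
Qed.

Lemma in_vals_tuple rs ts :
  In rs (vals_tuple ts) <-> Forall2 (fun r t => In r (vals t)) rs ts.
Proof.
  revert rs; induction ts as [|t ts IH]; intros rs; simpl.
  - split.
    + intros [<-|[]]; constructor.
    + inversion 1; auto.
  - rewrite in_flat_map; split.
    + intros [r [H1 H2]]; apply in_map_iff in H2; destruct H2 as [rs' [<- H2]].
      constructor; [exact H1|apply IH, H2].
    + inversion 1; subst; eexists; split; [eassumption|].
      apply in_map, IH; assumption.
Qed.

Lemma vals_tuple_length rs ts : In rs (vals_tuple ts) -> length rs = length ts.
Proof. rewrite in_vals_tuple; apply Forall2_length. Qed.

(* The upper bound forces [j <> 0]. *)
Lemma quotient_bounds i j k :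
  (k * Z.abs j <= Z.abs i < (k + 1) * Z.abs j)%Z <->
  j <> 0%Z /\ k = Z.abs (Z.quot i j).
Proof.
  split.
  - intros H.
    assert (Hj : j <> 0%Z) by (intros ->; simpl in H; lia).
    split; [exact Hj|].
    rewrite <- Z.quot_abs by exact Hj.
    rewrite Z.quot_div_nonneg by lia.
    (* For nonnegative arguments truncation is floor division, whose quotient is determined by a
       remainder in the range from 0 to [|j| - 1]; the two bounds put [|i| - k * |j|] in this
       range. *)
    apply Z.div_unique_pos with (Z.abs i - k * Z.abs j)%Z; nia.
  - intros [Hj ->].
    rewrite <- Z.quot_abs by exact Hj.
    rewrite Z.quot_div_nonneg by lia.
    pose proof (Z.div_mod (Z.abs i) (Z.abs j)).
    pose proof (Z.mod_pos_bound (Z.abs i) (Z.abs j)).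
    nia.
Qed.

(** Rounding toward zero makes the quotient odd in each argument, so its absolute value is the
    quotient of the absolute values and its sign is read off [i * j]. *)
Lemma quot_by_sign i j :
  j <> 0%Z ->
  ((i * j >= 0)%Z /\ Z.quot i j = Z.abs (Z.quot i j)) \/
  ((i * j < 0)%Z /\ Z.quot i j = (- Z.abs (Z.quot i j))%Z).
Proof.
  intros Hj; rewrite <- Z.quot_abs by exact Hj.
  destruct (Z_le_gt_dec 0 i), (Z_le_gt_dec 0 j).
  - left; rewrite !Z.abs_eq by lia; split; [nia|reflexivity].
  (* For [i = 0] the product is 0, so the nonnegative alternative applies although [j] is
     negative. *)
  - destruct (Z.eq_dec i 0) as [->|].
    + left; rewrite !Z.quot_0_l by lia; split; lia.
    + right; rewrite (Z.abs_eq i), (Z.abs_neq j), Z.quot_opp_r by lia.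
      split; nia.
  - right; rewrite (Z.abs_neq i), (Z.abs_eq j), Z.quot_opp_l by lia.
    split; nia.
  - left; rewrite (Z.abs_neq i), (Z.abs_neq j), Z.quot_opp_opp by lia.
    split; nia.
Qed.

Lemma tle_num ord m n : tle ord (num m) (num n) <-> (m <= n)%Z.
Proof.
  split.
  - intros H; destruct (Z.eq_dec m n); [lia|].
    apply Z.lt_le_incl, (tlt_num ord); split; [exact H|congruence].
  - intros H; destruct (Z.eq_dec m n) as [->|]; [apply tle_refl|].
    apply (tlt_num ord m n); lia.
Qed.

Lemma compare_num ord c m n :
  compare ord c (num m) (num n) <->
  match c with
  | Eq => m = n
  | Ne => m <> n
  | Lt => (m < n)%Z
  | Gt => (m > n)%Z
  | Le => (m <= n)%Z
  | Ge => (m >= n)%Z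
  end.
Proof.
  destruct c; simpl.
  - unfold num; split; congruence.
  - unfold num; split; congruence.
  - apply tlt_num.
  - etransitivity; [apply tlt_num|lia].
  - apply tle_num.
  - rewrite tle_num; lia.
Qed.

(** * Variables of terms *)

Fixpoint term_vars V (t : term V) : list V :=
  match t with
  | TPre _ => []
  | TVar x => [x]
  | TAbs t1 => term_vars t1
  | TBin _ t1 t2 => term_vars t1 ++ term_vars t2
  end.

Definition elem_vars V (b : body_elem V) : list V :=
  match b with
  | BLit _ a => flat_map (@term_vars V) (atom_args a)
  | BCmp _ t1 t2 => term_vars t1 ++ term_vars t2
  end.

Definition rule_vars V (R : rule V) : list V :=
  match head_lit R with
  | Some a => flat_map (@term_vars V) (atom_args a)
  | None => []
  end ++ flat_map (@elem_vars V) (body R).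

Lemma subst_term_ext V (s s' : V -> precomputed) t :
  (forall x, In x (term_vars t) -> s x = s' x) ->
  subst_term s t = subst_term s' t.
Proof.
  induction t; simpl; intros H; f_equal; auto using in_or_app.
Qed.

Lemma subst_atom_ext V (s s' : V -> precomputed) a :
  (forall x, In x (flat_map (@term_vars V) (atom_args a)) -> s x = s' x) ->
  subst_atom s a = subst_atom s' a.
Proof.
  intros H; unfold subst_atom; f_equal; apply map_ext_in; intros t Ht.
  apply subst_term_ext; intros x Hx; apply H, in_flat_map; eauto.
Qed.

Lemma subst_body_elem_ext V (s s' : V -> precomputed) b :
  (forall x, In x (elem_vars b) -> s x = s' x) ->
  subst_body_elem s b = subst_body_elem s' b.
Proof.
  destruct b; simpl; intros H; f_equal;
    auto using subst_atom_ext, subst_term_ext, in_or_app.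
Qed.

Lemma in_positive_body V (R : rule V) a :
  In a (positive_body R) <-> In (BLit NoNot a) (body R).
Proof.
  unfold positive_body; rewrite in_flat_map; split.
  - intros [[[| |] b|c t1 t2] [H1 H2]]; simpl in H2; try tauto.
    destruct H2 as [->|[]]; exact H1.
  - intros H; exists (BLit NoNot a); simpl; auto.
Qed.

(** Lets an instance be realised by an assignment that matches [s] only on the variables of the
    rule, as happens under the existential quantifiers of the completion. *)
Lemma subst_rule_parts_ext V (s s' : V -> precomputed) R :
  (forall x, In x (rule_vars R) -> s x = s' x) ->
  (forall a, head_lit R = Some a -> subst_atom s a = subst_atom s' a) /\
  map (subst_body_elem s) (body R) = map (subst_body_elem s') (body R) /\
  (forall b, In b (positive_body R) -> subst_atom s b = subst_atom s' b).
Proof.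
  unfold rule_vars; intros H.
  assert (Hb : forall b, In b (body R) ->
            forall x, In x (elem_vars b) -> s x = s' x).
  { intros b Hb x Hx; apply H, in_or_app; right; apply in_flat_map; eauto. }
  split; [|split].
  - intros a Ha; apply subst_atom_ext; intros x Hx.
    rewrite Ha in H; apply H, in_or_app; auto.
  - apply map_ext_in; intros b Hin; apply subst_body_elem_ext, Hb, Hin.
  - intros b Hin; apply in_positive_body in Hin.
    apply subst_atom_ext; exact (Hb _ Hin).
Qed.

(** * Program variables free in the formulas [val], [tauB] and [Form] *)

Lemma in_fv_FExs y ys F : In y (fv (FExs ys F)) <-> In y (fv F) /\ ~ In y ys.
Proof.
  induction ys as [|x ys IH]; simpl; [tauto|].
  split.
  - intros H; apply in_remove in H; rewrite IH in H; intuition congruence.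
  - intros H; apply in_in_remove; [|apply IH]; intuition congruence.
Qed.

Lemma in_fv_FConj y l : In y (fv (FConj l)) <-> exists F, In F l /\ In y (fv F).
Proof.
  induction l as [|F l IH]; simpl.
  - firstorder.
  - rewrite in_app_iff, IH; firstorder (subst; auto).
Qed.

(** The quantifiers inside [val] bind integer variables only, so no program variable of the term is
    lost. *)
Lemma fv_val x d t V :
  In x (term_vars t) -> In (GenVar (ProgVar x)) (fv (val d t V)).
Proof.
  revert d V; induction t as [r|y|t IH|o t1 IH1 t2 IH2]; intros d V Hx;
    simpl in Hx.
  - tauto.
  - destruct Hx as [->|[]]; simpl; apply in_or_app; simpl; auto.
  - simpl; apply in_in_remove; [congruence|].
    apply in_or_app; left; auto.
  - assert (H : In (GenVar (ProgVar x))
               (fv (val (S d) t1 (GInt (IVar (VarI d)))) ++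
                fv (val (S d) t2 (GInt (IVar (VarJ d)))))).
    { rewrite in_app_iff in *; destruct Hx; [left|right]; auto. }
    rewrite in_app_iff in H.
    unfold val; fold val; unfold binop_form; destruct o; rewrite in_fv_FExs;
      (split; [|simpl; intuition congruence]);
      apply in_fv_FConj; destruct H as [H|H];
      (eexists; split; [|exact H]; simpl; auto).
Qed.

Lemma fv_val_tuple x ts Vs :
  length ts = length Vs -> In x (flat_map (@term_vars variable) ts) ->
  In (GenVar (ProgVar x)) (fv (val_tuple ts Vs)).
Proof.
  unfold val_tuple; revert Vs; induction ts as [|t ts IH]; intros [|V Vs] Hl Hx;
    simpl in *; try tauto; try discriminate.
  rewrite in_app_iff in *; destruct Hx; [left|right].
  - apply fv_val; assumption.
  - apply IH; [congruence|assumption].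
Qed.

Lemma fv_tauB_elem x b :
  In x (elem_vars b) -> In (GenVar (ProgVar x)) (fv (tauB_elem b)).
Proof.
  destruct b as [s a|c t1 t2]; intros Hx; unfold tauB_elem; apply in_fv_FExs.
  - split.
    + simpl; apply in_or_app; left.
      apply fv_val_tuple; [rewrite fresh_tuple_length; reflexivity|exact Hx].
    + rewrite in_map_iff; intros [y [E Hy]].
      apply in_fresh_tuple in Hy; destruct Hy as [i ->]; discriminate.
  - split; [|simpl; intuition congruence].
    simpl in *; rewrite !in_app_iff in *; destruct Hx;
      auto using fv_val.
Qed.

Lemma fv_tauB x b :
  In x (flat_map (@elem_vars variable) b) ->
  In (GenVar (ProgVar x)) (fv (tauB b)).
Proof.
  rewrite in_flat_map; intros [c [Hc Hx]].
  apply in_fv_FConj; exists (tauB_elem c); split;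
    [apply in_map; exact Hc|apply fv_tauB_elem, Hx].
Qed.

(** The existential block of the completion can therefore realise every instance of the rule.
    Program variables are never among the head variables, which come from the reserve [FreshX]. *)
Lemma rule_vars_local x R a n :
  head_lit R = Some a -> length (atom_args a) = n -> In x (rule_vars R) ->
  In (GenVar (ProgVar x)) (local_vars R (fresh_tuple FreshX n)).
Proof.
  intros Ha Hn Hx; unfold local_vars, fv_except; apply filter_In; split.
  - assert (Hl : length (atom_args a) = length (fresh_tuple FreshX n))
      by (rewrite fresh_tuple_length; exact Hn).
    unfold rule_vars in Hx; rewrite Ha in Hx; apply in_app_or in Hx.
    unfold head_lit in Ha; unfold Form; destruct (head R);
      try discriminate; injection Ha as ->; simpl; rewrite !in_app_iff;
      (destruct Hx as [Hx|Hx];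
        [left; apply fv_val_tuple; assumption|right]).
    + apply fv_tauB, Hx.
    + left; apply fv_tauB, Hx.
  - destruct (in_dec var_eq_dec _ _) as [Hin|]; [|reflexivity].
    apply in_map_iff in Hin; destruct Hin as [y [E Hy]].
    apply in_fresh_tuple in Hy; destruct Hy as [i ->]; discriminate.
Qed.

Lemma local_vars_not_head R Xs x : In x Xs -> ~ In (GenVar x) (local_vars R Xs).
Proof.
  intros Hx H; unfold local_vars, fv_except in H; apply filter_In in H.
  destruct H as [_ H]; destruct (in_dec var_eq_dec _ _) as [|Hn];
    [discriminate|].
  apply Hn, in_map, Hx.
Qed.

(** * Meaning of val and tau^B in standard interpretations *)

Lemma psat_PConj I l : psat I (PConj l) <-> forall F, In F l -> psat I F.
Proof.
  induction l as [|G l IH]; simpl.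
  - tauto.
  - rewrite IH; firstorder (subst; auto).
Qed.

Lemma psat_PDisj I l : psat I (PDisj l) <-> exists F, In F l /\ psat I F.
Proof.
  induction l as [|G l IH]; simpl.
  - firstorder.
  - rewrite IH; firstorder (subst; auto).
Qed.

Lemma in_atoms_of F a :
  In F (atoms_of a) <->
  exists rs, In rs (vals_tuple (atom_args a)) /\ F = PAt (PAtom (atom_sym a) rs).
Proof.
  unfold atoms_of; rewrite in_map_iff; split; intros [rs []]; eauto.
Qed.

Lemma psat_tau_lit ord I s a :
  psat I (tau_body_elem ord (BLit s a)) <->
  exists rs, In rs (vals_tuple (atom_args a)) /\
    match s with
    | NoNot => I (PAtom (atom_sym a) rs)
    | Not => ~ I (PAtom (atom_sym a) rs)
    | NotNot => ~ ~ I (PAtom (atom_sym a) rs)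
    end.
Proof.
  unfold tau_body_elem; destruct s; rewrite psat_PDisj; split.
  - intros [F [HF H]]; apply in_atoms_of in HF; destruct HF as [rs [Hr ->]].
    eauto.
  - intros [rs [Hr H]]; eexists; split; [apply in_atoms_of; eauto|exact H].
  - intros [F [HF H]]; apply in_map_iff in HF; destruct HF as [G [<- HG]].
    apply in_atoms_of in HG; destruct HG as [rs [Hr ->]]; eauto.
  - intros [rs [Hr H]]; eexists; split;
      [apply in_map, in_atoms_of; eauto|exact H].
  - intros [F [HF H]]; apply in_map_iff in HF; destruct HF as [G [<- HG]].
    apply in_atoms_of in HG; destruct HG as [rs [Hr ->]]; eauto.
  - intros [rs [Hr H]]; eexists; split;
      [apply (in_map (fun F => PNeg (PNeg F))), in_atoms_of; eauto|exact H].
Qed.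

Lemma psat_tau_cmp ord I c t1 t2 :
  psat I (tau_body_elem ord (BCmp c t1 t2)) <->
  exists r1 r2, In r1 (vals t1) /\ In r2 (vals t2) /\ compare ord c r1 r2.
Proof.
  simpl; destruct (excluded_middle_informative _); simpl; tauto.
Qed.

Section Standard.

Variables (ord : term_order) (I : atom_set).
Variable lvl : symbol -> list precomputed -> numeral.

Local Notation J := (@Build_interp_lvl (standard ord I) lvl).

Definition prog_val (e : assignment J) (x : variable) : precomputed :=
  gen_val e (ProgVar x).

Definition gen_vals (e : assignment J) (xs : list gvar) : list precomputed :=
  map (gen_val e) xs.

Definition ivar_index (x : ivar) : nat :=
  match x with VarI d | VarJ d | VarK d => d end.

(** How the assignment may change on entering the quantifiers of [val d]: these bind integer
    variables of index at least [d] and no general variables. *)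
Definition same_below (d : nat) (e e' : assignment J) : Prop :=
  (forall x, gen_val e' x = gen_val e x) /\
  (forall x, ivar_index x < d -> int_val e' x = int_val e x).

(* Rules out capture by the integer variables that [val d] binds. *)
Definition fixed_below (d : nat) (V : gterm) : Prop :=
  forall e e', same_below d e e' -> geval e' V = geval e V.

Lemma fixed_below_GVar d x : fixed_below d (GVar x).
Proof. intros e e' [H _]; apply H. Qed.

Lemma fixed_below_IVar d x : ivar_index x < d -> fixed_below d (GInt (IVar x)).
Proof. intros Hd e e' [_ H]; simpl; f_equal; apply H, Hd. Qed.

Lemma geval_gconst (e : assignment J) r : geval e (gconst r) = r.
Proof. destruct r; reflexivity. Qed.

Lemma agree_off_same_below d ys e e' :
  (forall y, In y ys -> exists x, y = IntVar x /\ d <= ivar_index x) ->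
  agree_off ys e e' -> same_below d e e'.
Proof.
  intros Hy [H1 H2]; split; intros x.
  - apply H1; intros H; apply Hy in H; destruct H as [y [E _]]; discriminate.
  - intros Hd; apply H2; intros H; apply Hy in H; destruct H as [y [E Hy']].
    injection E as <-; lia.
Qed.

Lemma assign_IJ d (e : assignment J) (m n : Z) :
  exists e', agree_off [IntVar (VarI d); IntVar (VarJ d)] e e' /\
    int_val e' (VarI d) = overline m /\ int_val e' (VarJ d) = overline n.
Proof.
  set (e' := upd_int (upd_int e (VarI d) (overline m : int_dom (reduct J)))
               (VarJ d) (overline n : int_dom (reduct J))).
  exists e'; split; [|split].
  - apply agree_off_int; eexists; apply agree_off_int; eexists.
    apply agree_off_nil; reflexivity.
  - simpl; destruct (ivar_eq_dec (VarI d) (VarJ d)); [discriminate|].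
    destruct (ivar_eq_dec (VarI d) (VarI d)); congruence.
  - simpl; destruct (ivar_eq_dec (VarJ d) (VarJ d)); congruence.
Qed.

Lemma assign_IJK d (e : assignment J) (m n k : Z) :
  exists e',
    agree_off [IntVar (VarI d); IntVar (VarJ d); IntVar (VarK d)] e e' /\
    int_val e' (VarI d) = overline m /\ int_val e' (VarJ d) = overline n /\
    int_val e' (VarK d) = overline k.
Proof.
  destruct (assign_IJ d e m n) as [e1 [[H1 H2] [HI HJ]]].
  exists (upd_int e1 (VarK d) (overline k : int_dom (reduct J))); split.
  - split; simpl; intros x Hx.
    + apply H1; simpl; tauto.
    + destruct (ivar_eq_dec x (VarK d)) as [->|n0]; [tauto|].
      apply H2; simpl; tauto.
  - simpl; destruct (ivar_eq_dec (VarI d) (VarK d)); [discriminate|].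
    destruct (ivar_eq_dec (VarJ d) (VarK d)); [discriminate|].
    destruct (ivar_eq_dec (VarK d) (VarK d)); [|congruence]; auto.
Qed.

Lemma sat_quotient_form (e : assignment J) d (i j k : Z) :
  int_val e (VarI d) = overline i -> int_val e (VarJ d) = overline j ->
  int_val e (VarK d) = overline k ->
  sat e (quotient_form (IVar (VarI d)) (IVar (VarJ d)) (IVar (VarK d))) <->
  j <> 0%Z /\ k = Z.abs (Z.quot i j).
Proof.
  intros HI HJ HK; rewrite <- quotient_bounds; simpl; rewrite HI, HJ, HK.
  unfold lift1, lift2; simpl.
  rewrite (compare_num ord Le (k * Z.abs j) (Z.abs i)).
  rewrite (compare_num ord Lt (Z.abs i) ((k + 1) * Z.abs j)).
  reflexivity.
Qed.

Lemma sat_by_sign (e : assignment J) d V T1 T2 (i j t1 t2 : Z) :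
  int_val e (VarI d) = overline i -> int_val e (VarJ d) = overline j ->
  ieval e T1 = overline t1 -> ieval e T2 = overline t2 ->
  sat e (by_sign (IVar (VarI d)) (IVar (VarJ d)) V T1 T2) <->
  ((i * j >= 0)%Z /\ geval e V = num t1) \/
  ((i * j < 0)%Z /\ geval e V = num t2).
Proof.
  intros HI HJ H1 H2; simpl; rewrite HI, HJ, H1, H2; unfold lift2; simpl.
  rewrite (compare_num ord Ge (i * j) 0), (compare_num ord Lt (i * j) 0).
  reflexivity.
Qed.

(** The subterm formulas enter only through the predicates [P1] and [P2], which separates the
    arithmetic of the six operations from the induction on terms. *)
Lemma sat_binop_form o d V F1 F2 (P1 P2 : Z -> Prop) (e : assignment J) :
  fixed_below d V ->
  (forall e' n, same_below d e e' -> int_val e' (VarI d) = overline n ->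
     (sat e' F1 <-> P1 n)) ->
  (forall e' n, same_below d e e' -> int_val e' (VarJ d) = overline n ->
     (sat e' F2 <-> P2 n)) ->
  sat e (binop_form o d V F1 F2) <->
  exists n1 n2 k, P1 n1 /\ P2 n2 /\ In k (binop_vals o n1 n2) /\
    geval e V = num k.
Proof.
  intros HV H1 H2.
  assert (HIJ : forall e', agree_off [IntVar (VarI d); IntVar (VarJ d)] e e' ->
            same_below d e e').
  { intros e'; apply agree_off_same_below; simpl.
    intros y [<-|[<-|[]]]; eexists; split; try reflexivity; simpl; lia. }
  assert (HIJK : forall e',
            agree_off [IntVar (VarI d); IntVar (VarJ d); IntVar (VarK d)] e e' ->
            same_below d e e').
  { intros e'; apply agree_off_same_below; simpl.
    intros y [<-|[<-|[<-|[]]]]; eexists; split; try reflexivity; simpl; lia. }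
  assert (E2 : forall G Q,
    (forall e' i j, same_below d e e' -> int_val e' (VarI d) = overline i ->
       int_val e' (VarJ d) = overline j -> (sat e' G <-> Q i j)) ->
    (sat e (FExs [IntVar (VarI d); IntVar (VarJ d)] (FConj [F1; F2; G])) <->
     exists i j, P1 i /\ P2 j /\ Q i j)).
  { intros G Q HG; rewrite sat_FExs; split.
    - intros [e' [Ha Hs]]; pose proof (HIJ _ Ha) as Hb.
      destruct (int_val e' (VarI d)) as [i] eqn:EI.
      destruct (int_val e' (VarJ d)) as [j] eqn:EJ.
      destruct Hs as (S1 & S2 & S3 & _).
      exists i, j; split; [eapply H1; eauto|split; [eapply H2; eauto|]].
      eapply HG; eauto.
    - intros (i & j & S1 & S2 & S3).
      destruct (assign_IJ d e i j) as (e' & Ha & EI & EJ).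
      pose proof (HIJ _ Ha) as Hb.
      exists e'; split; [exact Ha|].
      split; [eapply H1; eauto|split; [eapply H2; eauto|]].
      split; [eapply HG; eauto|exact (fun x => x)]. }
  assert (E3 : forall G1 G2 Q,
    (forall e' i j k, same_below d e e' -> int_val e' (VarI d) = overline i ->
       int_val e' (VarJ d) = overline j -> int_val e' (VarK d) = overline k ->
       (sat e' (FAnd G1 G2) <-> Q i j k)) ->
    (sat e (FExs [IntVar (VarI d); IntVar (VarJ d); IntVar (VarK d)]
              (FConj [F1; F2; G1; G2])) <->
     exists i j k, P1 i /\ P2 j /\ Q i j k)).
  { intros G1 G2 Q HG; rewrite sat_FExs; split.
    - intros [e' [Ha Hs]]; pose proof (HIJK _ Ha) as Hb.
      destruct (int_val e' (VarI d)) as [i] eqn:EI.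
      destruct (int_val e' (VarJ d)) as [j] eqn:EJ.
      destruct (int_val e' (VarK d)) as [k] eqn:EK.
      destruct Hs as (S1 & S2 & S3 & S4 & _).
      exists i, j, k; split; [eapply H1; eauto|split; [eapply H2; eauto|]].
      eapply HG; eauto; split; assumption.
    - intros (i & j & k & S1 & S2 & S3).
      destruct (assign_IJK d e i j k) as (e' & Ha & EI & EJ & EK).
      pose proof (HIJK _ Ha) as Hb.
      apply (proj2 (HG _ _ _ _ Hb EI EJ EK)) in S3.
      exists e'; split; [exact Ha|].
      split; [eapply H1; eauto|split; [eapply H2; eauto|]].
      split; [apply S3|split; [apply S3|exact (fun x => x)]]. }
  unfold binop_form; destruct o.
  - rewrite (E2 _ (fun i j => geval e V = num (i + j))).
    + simpl; split.
      * intros (i & j & A & B & C); exists i, j, (i + j)%Z; auto.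
      * intros (i & j & k & A & B & [<-|[]] & D); eauto.
    + intros e' i j Hb EI EJ; simpl; rewrite EI, EJ, (HV _ _ Hb); reflexivity.
  - rewrite (E2 _ (fun i j => geval e V = num (i - j))).
    + simpl; split.
      * intros (i & j & A & B & C); exists i, j, (i - j)%Z; auto.
      * intros (i & j & k & A & B & [<-|[]] & D); eauto.
    + intros e' i j Hb EI EJ; simpl; rewrite EI, EJ, (HV _ _ Hb); reflexivity.
  - rewrite (E2 _ (fun i j => geval e V = num (i * j))).
    + simpl; split.
      * intros (i & j & A & B & C); exists i, j, (i * j)%Z; auto.
      * intros (i & j & k & A & B & [<-|[]] & D); eauto.
    + intros e' i j Hb EI EJ; simpl; rewrite EI, EJ, (HV _ _ Hb); reflexivity.
  - rewrite (E3 _ _ (fun i j k =>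
      (j <> 0%Z /\ k = Z.abs (Z.quot i j)) /\
      (((i * j >= 0)%Z /\ geval e V = num k) \/
       ((i * j < 0)%Z /\ geval e V = num (0 - k))))).
    + simpl; split.
      * intros (i & j & k & A & B & (Hj & ->) & C).
        (* The variable [K] holds the absolute value of the quotient, while the value of the term is
           the signed quotient; [quot_by_sign] converts, and the mismatched sign cases are
           contradictory. *)
        exists i, j, (Z.quot i j); repeat (split; [assumption|]).
        rewrite (proj2 (Z.eqb_neq j 0) Hj); split; [simpl; auto|].
        destruct (quot_by_sign i Hj) as [[X Y]|[X Y]], C as [[C D]|[C D]];
          try lia; rewrite D; f_equal; lia.
      * intros (i & j & k & A & B & C & D).
        destruct (Z.eqb_spec j 0) as [|Hj]; [destruct C|].
        destruct C as [<-|[]].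
        exists i, j, (Z.abs (Z.quot i j)); repeat (split; [assumption|]).
        split; [auto|].
        destruct (quot_by_sign i Hj) as [[X Y]|[X Y]]; [left|right];
          (split; [exact X|rewrite D; f_equal; lia]).
    + intros e' i j k Hb EI EJ EK.
      rewrite <- (HV _ _ Hb), <- (sat_quotient_form e' d EI EJ EK).
      rewrite <- (@sat_by_sign e' d V (IVar (VarK d))
                    (ISub (IZ 0) (IVar (VarK d))) i j k (0 - k) EI EJ);
        [reflexivity|exact EK|simpl; rewrite EK; reflexivity].
  - rewrite (E3 _ _ (fun i j k =>
      (j <> 0%Z /\ k = Z.abs (Z.quot i j)) /\
      (((i * j >= 0)%Z /\ geval e V = num (i - k * j)) \/
       ((i * j < 0)%Z /\ geval e V = num (i + k * j))))).
    + simpl; split.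
      * intros (i & j & k & A & B & (Hj & ->) & C).
        (* When [i * j] is negative the quotient is [-k], which turns [i - j * quot] into the
           [i + k * j] of the second disjunct. *)
        exists i, j, (i - j * Z.quot i j)%Z; repeat (split; [assumption|]).
        rewrite (proj2 (Z.eqb_neq j 0) Hj); split; [simpl; auto|].
        destruct (quot_by_sign i Hj) as [[X Y]|[X Y]], C as [[C D]|[C D]];
          try lia; rewrite D; f_equal; nia.
      * intros (i & j & k & A & B & C & D).
        destruct (Z.eqb_spec j 0) as [|Hj]; [destruct C|].
        destruct C as [<-|[]].
        exists i, j, (Z.abs (Z.quot i j)); repeat (split; [assumption|]).
        split; [auto|].
        destruct (quot_by_sign i Hj) as [[X Y]|[X Y]]; [left|right];
          (split; [exact X|rewrite D; f_equal; nia]).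
    + intros e' i j k Hb EI EJ EK.
      rewrite <- (HV _ _ Hb), <- (sat_quotient_form e' d EI EJ EK).
      rewrite <- (@sat_by_sign e' d V
        (ISub (IVar (VarI d)) (IMul (IVar (VarK d)) (IVar (VarJ d))))
        (IAdd (IVar (VarI d)) (IMul (IVar (VarK d)) (IVar (VarJ d))))
        i j (i - k * j) (i + k * j) EI EJ);
        [reflexivity|simpl; rewrite EI, EJ, EK; reflexivity..].
  - rewrite (E3 _ _ (fun i j k => (i <= k <= j)%Z /\ geval e V = num k)).
    + split; intros (i & j & k & A & B & C & D); exists i, j, k;
        rewrite in_binop_vals_Interval in *; auto.
    + intros e' i j k Hb EI EJ EK; simpl; rewrite EI, EJ, EK, (HV _ _ Hb).
      change (tle ord (Num (overline i)) (Num (overline k)))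
        with (compare ord Le (num i) (num k)).
      change (tle ord (Num (overline k)) (Num (overline j)))
        with (compare ord Le (num k) (num j)).
      rewrite !compare_num; reflexivity.
Qed.

Lemma prog_val_same_below d e e' :
  same_below d e e' -> prog_val e' = prog_val e.
Proof.
  intros [H _]; apply functional_extensionality; intros x; apply H.
Qed.

(** The induction generalises [d] and [V]: a subterm is treated at depth [S d] with an integer
    variable of index [d] as its value term, which the deeper quantifiers leave fixed. *)
Lemma sat_val t d V (e : assignment J) :
  fixed_below d V ->
  sat e (val d t V) <->
  @In precomputed (geval e V) (vals (subst_term (prog_val e) t)).
Proof.
  revert d V e; induction t as [r|x|t IH|o t1 IH1 t2 IH2]; intros d V e HV.
  - simpl; rewrite geval_gconst; split; [auto|intros [H|[]]; auto].
  - simpl; split; [auto|intros [H|[]]; auto].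
  - change (subst_term (prog_val e) (TAbs t))
      with (TAbs (subst_term (prog_val e) t)).
    rewrite in_vals_TAbs; unfold val; fold val.
    change (FEx (IntVar (VarI d))) with (FExs [IntVar (VarI d)]).
    assert (Hb : forall e', agree_off [IntVar (VarI d)] e e' ->
              same_below d e e').
    { intros e'; apply agree_off_same_below; simpl.
      intros y [<-|[]]; eexists; split; [reflexivity|simpl; lia]. }
    rewrite sat_FExs; split.
    + intros (e' & Ha & S1 & S2); apply Hb in Ha.
      rewrite IH in S1 by (apply fixed_below_IVar; simpl; lia).
      rewrite (prog_val_same_below Ha) in S1.
      simpl in S1, S2; rewrite (HV _ _ Ha) in S2.
      destruct (int_val e' (VarI d)) as [n]; exists n; split; assumption.
    + intros (n & S1 & S2).
      exists (upd_int e (VarI d) (overline n : int_dom (reduct J))).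
      match goal with |- agree_off _ _ ?x /\ _ => set (e' := x) end.
      assert (Ha : agree_off [IntVar (VarI d)] e e').
      { apply agree_off_int; eexists; apply agree_off_nil; reflexivity. }
      assert (EI : int_val e' (VarI d) = overline n).
      { simpl; destruct (ivar_eq_dec (VarI d) (VarI d)); congruence. }
      clearbody e'; split; [exact Ha|]; apply Hb in Ha; split.
      * rewrite IH by (apply fixed_below_IVar; simpl; lia).
        rewrite (prog_val_same_below Ha); simpl geval; rewrite EI; exact S1.
      * simpl sat; rewrite EI, (HV _ _ Ha); exact S2.
  - change (subst_term (prog_val e) (TBin o t1 t2))
      with (TBin o (subst_term (prog_val e) t1) (subst_term (prog_val e) t2)).
    rewrite in_vals_TBin; unfold val; fold val.
    rewrite (@sat_binop_form o d V _ _
      (fun n => In (num n) (vals (subst_term (prog_val e) t1)))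
      (fun n => In (num n) (vals (subst_term (prog_val e) t2))) e HV).
    + reflexivity.
    + intros e' n Hb EI.
      rewrite IH1 by (apply fixed_below_IVar; simpl; lia).
      rewrite (prog_val_same_below Hb); simpl geval; rewrite EI; reflexivity.
    + intros e' n Hb EJ.
      rewrite IH2 by (apply fixed_below_IVar; simpl; lia).
      rewrite (prog_val_same_below Hb); simpl geval; rewrite EJ; reflexivity.
Qed.

Lemma sat_val_tuple ts Vs (e : assignment J) :
  length ts = length Vs ->
  sat e (val_tuple ts Vs) <->
  In (gen_vals e Vs)
    (vals_tuple (map (subst_term (prog_val e)) ts)).
Proof.
  unfold val_tuple; rewrite in_vals_tuple.
  revert Vs; induction ts as [|t ts IH]; intros [|V Vs] Hl; simpl in Hl;
    try discriminate.
  - simpl; split; [constructor|tauto].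
  - injection Hl as Hl; simpl; specialize (IH Vs Hl); unfold FConj in IH.
    rewrite IH, sat_val by apply fixed_below_GVar; simpl; split.
    + intros [H1 H2]; constructor; assumption.
    + inversion 1; subst; auto.
Qed.

Lemma gen_vals_agree_off ys e e' xs :
  agree_off ys e e' -> (forall x, In x xs -> ~ In (GenVar x) ys) ->
  gen_vals e' xs = gen_vals e xs.
Proof. intros [H _] Hd; apply map_ext_in; auto. Qed.

Lemma prog_val_agree_off ys e e' :
  (forall x, ~ In (GenVar (ProgVar x)) ys) -> agree_off ys e e' ->
  prog_val e' = prog_val e.
Proof.
  intros Hy [H _]; apply functional_extensionality; intros x; apply H, Hy.
Qed.

(** The shape shared by body literals and [lower_level]. Injectivity of [f] lets the fresh variables
    take any tuple of values, and avoiding program variables keeps the instance unchanged inside the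
    block. *)
Lemma sat_ex_val_tuple f ts G (e : assignment J) (Q : list precomputed -> Prop) :
  (forall i j, f i = f j -> i = j) ->
  (forall i x, f i <> ProgVar x) ->
  (forall e', agree_off (map GenVar (fresh_tuple f (length ts))) e e' ->
     (sat e' G <-> Q (gen_vals e' (fresh_tuple f (length ts))))) ->
  sat e (FExs (map GenVar (fresh_tuple f (length ts)))
           (FAnd (val_tuple ts (fresh_tuple f (length ts))) G)) <->
  exists rs, In rs (vals_tuple (map (subst_term (prog_val e)) ts)) /\ Q rs.
Proof.
  intros Hinj Hp HG.
  assert (Hpv : forall e',
    agree_off (map GenVar (fresh_tuple f (length ts))) e e' ->
    prog_val e' = prog_val e).
  { intros e'; apply prog_val_agree_off; intros x Hx.
    apply in_map_iff in Hx; destruct Hx as [y [E Hy]].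
    apply in_fresh_tuple in Hy; destruct Hy as [i ->].
    injection E as E; exact (Hp _ _ E). }
  rewrite sat_FExs; split.
  - intros (e' & Ha & S1 & S2).
    rewrite sat_val_tuple, (Hpv _ Ha) in S1
      by (rewrite fresh_tuple_length; reflexivity).
    eexists; split; [exact S1|apply HG; assumption].
  - intros (rs & S1 & S2).
    destruct (assign_tuple e rs (fresh_tuple_NoDup f (length ts) Hinj))
      as (e' & Ha & Hrs).
    { apply vals_tuple_length in S1; rewrite length_map in S1.
      rewrite fresh_tuple_length; auto. }
    fold (gen_vals e' (fresh_tuple f (length ts))) in Hrs.
    exists e'; split; [exact Ha|split].
    + rewrite sat_val_tuple, (Hpv _ Ha)
        by (rewrite fresh_tuple_length; reflexivity).
      rewrite Hrs; exact S1.
    + apply HG; [exact Ha|]; rewrite Hrs; exact S2.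
Qed.

Lemma map_geval_gvars (e : assignment J) xs :
  map (geval e) (gvars xs) = gen_vals e xs.
Proof. unfold gvars; rewrite map_map; reflexivity. Qed.

Lemma sat_tauB_elem (e : assignment J) b :
  sat e (tauB_elem b) <->
  psat I (tau_body_elem ord (subst_body_elem (prog_val e) b)).
Proof.
  destruct b as [s a|c t1 t2].
  - change (subst_body_elem (prog_val e) (BLit s a))
      with (BLit s (subst_atom (prog_val e) a)).
    rewrite psat_tau_lit; apply sat_ex_val_tuple.
    + congruence.
    + discriminate.
    + intros e' _; destruct s; simpl; rewrite map_geval_gvars; reflexivity.
  - change (subst_body_elem (prog_val e) (BCmp c t1 t2))
      with (BCmp c (subst_term (prog_val e) t1) (subst_term (prog_val e) t2)).
    rewrite psat_tau_cmp.
    unfold tauB_elem; rewrite sat_FExs.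
    assert (Hpv : forall e',
      agree_off [GenVar (FreshV 0); GenVar (FreshV 1)] e e' ->
      prog_val e' = prog_val e).
    { intros e'; apply prog_val_agree_off; intros x; simpl.
      intuition congruence. }
    split.
    + intros (e' & Ha & S1 & S2 & S3 & _).
      rewrite sat_val, (Hpv _ Ha) in S1, S2 by apply fixed_below_GVar.
      eauto.
    + intros (r1 & r2 & S1 & S2 & S3).
      destruct (@assign_tuple J e (fresh_tuple FreshV 2) [r1; r2])
        as (e' & Ha & Hr); [|reflexivity|].
      { apply fresh_tuple_NoDup; congruence. }
      injection Hr as Hr1 Hr2.
      exists e'; split; [exact Ha|].
      split; [|split; [|split; [|exact (fun x => x)]]].
      * rewrite sat_val, (Hpv _ Ha) by apply fixed_below_GVar.
        simpl geval; rewrite Hr1; exact S1.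
      * rewrite sat_val, (Hpv _ Ha) by apply fixed_below_GVar.
        simpl geval; rewrite Hr2; exact S2.
      * simpl; rewrite Hr1, Hr2; exact S3.
Qed.

Lemma sat_tauB (e : assignment J) b :
  sat e (tauB b) <->
  psat I (tau_body ord (map (subst_body_elem (prog_val e)) b)).
Proof.
  unfold tauB, tau_body; rewrite sat_FConj, psat_PConj; split.
  - intros H F HF; apply in_map_iff in HF; destruct HF as [c [<- Hc]].
    apply in_map_iff in Hc; destruct Hc as [b' [<- Hb]].
    apply sat_tauB_elem, H, in_map, Hb.
  - intros H F HF; apply in_map_iff in HF; destruct HF as [b' [<- Hb]].
    apply sat_tauB_elem, H, in_map, in_map, Hb.
Qed.

(** The conjunct for choice rules is doubly negated; classically it is membership of the head atom
    in [I]. Stating it as an implication from [head R = HChoice a] covers both kinds of rule. *)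
Lemma sat_Form (e : assignment J) R a Xs :
  head_lit R = Some a -> length (atom_args a) = length Xs ->
  sat e (Form R Xs) <->
  In (gen_vals e Xs)
     (vals_tuple (map (subst_term (prog_val e)) (atom_args a))) /\
  psat I (tau_body ord (map (subst_body_elem (prog_val e)) (body R))) /\
  (head R = HChoice a -> I (PAtom (atom_sym a) (gen_vals e Xs))).
Proof.
  unfold head_lit, Form; intros Ha Hl.
  destruct (head R) as [b|b|]; try discriminate; injection Ha as ->.
  - simpl; rewrite sat_val_tuple, sat_tauB by exact Hl.
    intuition discriminate.
  - simpl; rewrite sat_val_tuple, sat_tauB, map_geval_gvars by exact Hl.
    fold (~ I (PAtom (atom_sym a) (gen_vals e Xs))).
    intuition.
    apply NNPP; auto.
Qed.

Lemma sat_lower_level (e : assignment J) p n b :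
  sat e (lower_level (p, n) (fresh_tuple FreshX n) b) <->
  exists rs, In rs (vals_tuple (atom_args (subst_atom (prog_val e) b))) /\
    I (PAtom (atom_sym b) rs) /\
    (int_of (lvl (atom_sym b) rs) <
     int_of (lvl p (gen_vals e (fresh_tuple FreshX n))))%Z.
Proof.
  apply sat_ex_val_tuple.
  - congruence.
  - discriminate.
  - intros e' Ha; simpl; rewrite !map_geval_gvars.
    (* The block binds variables from [FreshZ] only, so the head tuple and its level are those of
       the outer assignment. *)
    rewrite (gen_vals_agree_off (fresh_tuple FreshX n) Ha).
    + destruct (lvl (atom_sym b) _) as [k1], (lvl p _) as [k2].
      change (tlt ord (Num (overline k1)) (Num (overline k2)))
        with (compare ord Lt (num k1) (num k2)).
      rewrite compare_num; simpl; tauto.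
    + intros x Hx Hin; apply in_fresh_tuple in Hx; destruct Hx as [i ->].
      apply in_map_iff in Hin; destruct Hin as [y [E Hy]].
      apply in_fresh_tuple in Hy; destruct Hy as [j ->]; discriminate.
Qed.

End Standard.

(** * Reducts *)

Section Reduct.

Variables (ord : term_order) (I I' : atom_set).

(** A formula false in [I] has falsity as its reduct, which no set satisfies. *)
Lemma psat_preduct_orig F : psat I' (preduct I F) -> psat I F.
Proof.
  destruct F; simpl; destruct (excluded_middle_informative _) as [H|H];
    simpl; tauto.
Qed.

(** Inclusion of [I'] in [I] is not assumed in this section, hence membership in both sets here and
    in [holds_in]. *)
Lemma psat_preduct_atom a : psat I' (preduct I (PAt a)) <-> I a /\ I' a.
Proof. simpl; destruct (excluded_middle_informative _); simpl; tauto. Qed.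

Lemma psat_preduct_and F G :
  psat I' (preduct I (PAnd F G)) <->
  psat I' (preduct I F) /\ psat I' (preduct I G).
Proof.
  pose proof (psat_preduct_orig F); pose proof (psat_preduct_orig G).
  simpl; destruct (excluded_middle_informative _); simpl; tauto.
Qed.

Lemma psat_preduct_or F G :
  psat I' (preduct I (POr F G)) <->
  psat I' (preduct I F) \/ psat I' (preduct I G).
Proof.
  pose proof (psat_preduct_orig F); pose proof (psat_preduct_orig G).
  simpl; destruct (excluded_middle_informative _); simpl; tauto.
Qed.

(** The here-and-there clause: an implication is tested in [I], since otherwise its reduct is
    falsity, and again between the reducts of its two sides. *)
Lemma psat_preduct_imp F G :
  psat I' (preduct I (PImp F G)) <->
  (psat I F -> psat I G) /\
  (psat I' (preduct I F) -> psat I' (preduct I G)).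
Proof.
  simpl; destruct (excluded_middle_informative _); simpl; tauto.
Qed.

Lemma psat_preduct_bot : psat I' (preduct I PBot) <-> False.
Proof. simpl; destruct (excluded_middle_informative _); simpl; tauto. Qed.

Lemma psat_preduct_neg F : psat I' (preduct I (PNeg F)) <-> ~ psat I F.
Proof.
  pose proof (psat_preduct_orig F).
  unfold PNeg; rewrite psat_preduct_imp, psat_preduct_bot; simpl; tauto.
Qed.

Lemma psat_preduct_conj l :
  psat I' (preduct I (PConj l)) <->
  forall F, In F l -> psat I' (preduct I F).
Proof.
  induction l as [|G l IH]; simpl PConj.
  - unfold PTop; rewrite psat_preduct_neg; simpl; tauto.
  - rewrite psat_preduct_and, IH; simpl; firstorder (subst; auto).
Qed.

Lemma psat_preduct_disj l :
  psat I' (preduct I (PDisj l)) <->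
  exists F, In F l /\ psat I' (preduct I F).
Proof.
  induction l as [|G l IH]; simpl PDisj.
  - rewrite psat_preduct_bot; firstorder.
  - rewrite psat_preduct_or, IH; simpl; firstorder (subst; auto).
Qed.

Definition holds_in (K : atom_set) (b : atom ground) : Prop :=
  exists rs, In rs (vals_tuple (atom_args b)) /\
    I (PAtom (atom_sym b) rs) /\ K (PAtom (atom_sym b) rs).

(* Negated literals and comparisons survive or vanish according to [I] alone,
   so only the positive literals see [I']. *)
Lemma psat_preduct_elem b :
  psat I' (preduct I (tau_body_elem ord b)) <->
  psat I (tau_body_elem ord b) /\
  (forall a, b = BLit NoNot a -> holds_in I' a).
Proof.
  destruct b as [[| |] a|c t1 t2].
  - simpl tau_body_elem; split.
    + intros H; split; [exact (psat_preduct_orig _ H)|].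
      intros a' E; injection E as <-.
      apply psat_preduct_disj in H; destruct H as [F [HF H]].
      apply in_atoms_of in HF; destruct HF as [rs [Hr ->]].
      apply psat_preduct_atom in H; exists rs; tauto.
    + intros [_ H]; destruct (H a eq_refl) as [rs [Hr H']].
      apply psat_preduct_disj; eexists; split.
      * apply in_atoms_of; eauto.
      * apply psat_preduct_atom, H'.
  - split.
    + intros H; split; [exact (psat_preduct_orig _ H)|discriminate].
    + intros [H _]; simpl in *; apply psat_PDisj in H.
      destruct H as [F [HF H]]; apply psat_preduct_disj; exists F.
      split; [exact HF|].
      apply in_map_iff in HF; destruct HF as [G [<- _]].
      apply psat_preduct_neg, H.
  - split.
    + intros H; split; [exact (psat_preduct_orig _ H)|discriminate].
    + intros [H _]; simpl in *; apply psat_PDisj in H.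
      destruct H as [F [HF H]]; apply psat_preduct_disj; exists F.
      split; [exact HF|].
      apply in_map_iff in HF; destruct HF as [G [<- _]].
      apply psat_preduct_neg, H.
  - split.
    + intros H; split; [exact (psat_preduct_orig _ H)|discriminate].
    + intros [H _]; simpl tau_body_elem in *.
      destruct (excluded_middle_informative _); [|destruct H].
      apply psat_preduct_neg; simpl; tauto.
Qed.

Lemma psat_preduct_body b :
  psat I' (preduct I (tau_body ord b)) <->
  psat I (tau_body ord b) /\
  (forall a, In (BLit NoNot a) b -> holds_in I' a).
Proof.
  unfold tau_body; rewrite psat_preduct_conj, psat_PConj.
  split.
  - intros H; split.
    + intros F HF; exact (psat_preduct_orig _ (H F HF)).
    + intros a Ha; apply (psat_preduct_elem (BLit NoNot a)); [|reflexivity].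
      apply H, in_map, Ha.
  - intros [H1 H2] F HF; pose proof (H1 _ HF) as H.
    apply in_map_iff in HF; destruct HF as [c [<- Hc]].
    apply psat_preduct_elem; split; [exact H|]; intros a ->; auto.
Qed.

(** A choice rule demands nothing for a head atom outside [I], where the negated disjunct holds in
    the reduct; for a head atom in [I] it acts like a basic rule. *)
Lemma psat_preduct_head_rule R a :
  head_lit R = Some a ->
  psat I' (preduct I (tau_rule ord R)) <->
  (psat I (tau_body ord (body R)) ->
   forall rs, In rs (vals_tuple (atom_args a)) ->
   (head R = HChoice a -> I (PAtom (atom_sym a) rs)) ->
   I (PAtom (atom_sym a) rs) /\
   (psat I' (preduct I (tau_body ord (body R))) ->
    I' (PAtom (atom_sym a) rs))).
Proof.
  pose proof (psat_preduct_orig (tau_body ord (body R))) as Ho.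
  unfold head_lit, tau_rule; destruct (head R) as [b|b|]; intros E;
    try discriminate; injection E as ->;
    rewrite psat_preduct_imp, psat_PConj, psat_preduct_conj; split.
  - intros [H1 H2] Hb rs Hr _; split.
    + apply (H1 Hb (PAt _)), in_atoms_of; eauto.
    + intros Hb'; apply psat_preduct_atom, H2; [exact Hb'|].
      apply in_atoms_of; eauto.
  - intros H; split.
    + intros Hb F HF; apply in_atoms_of in HF; destruct HF as [rs [Hr ->]].
      apply H; [exact Hb|exact Hr|discriminate].
    + intros Hb F HF; apply in_atoms_of in HF; destruct HF as [rs [Hr ->]].
      apply psat_preduct_atom.
      destruct (H (Ho Hb) rs Hr); [discriminate|auto].
  - intros [H1 H2] Hb rs Hr HI; specialize (HI eq_refl).
    split; [exact HI|]; intros Hb'.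
    (* As the head atom is in [I], the reduct of its negation fails and only the atom itself can
       satisfy the disjunction. *)
    assert (Hor : psat I' (preduct I (POr (PAt (PAtom (atom_sym a) rs))
                             (PNeg (PAt (PAtom (atom_sym a) rs)))))).
    { apply H2; [exact Hb'|].
      apply (in_map (fun F => POr F (PNeg F))), in_atoms_of; eauto. }
    rewrite psat_preduct_or, psat_preduct_atom, psat_preduct_neg in Hor.
    simpl in Hor; tauto.
  - intros H; split.
    + intros _ F HF; apply in_map_iff in HF; destruct HF as [G [<- _]].
      simpl; apply classic.
    + intros Hb F HF; apply in_map_iff in HF; destruct HF as [G [<- HG]].
      apply in_atoms_of in HG; destruct HG as [rs [Hr ->]].
      rewrite psat_preduct_or, psat_preduct_atom, psat_preduct_neg; simpl.
      destruct (classic (I (PAtom (atom_sym a) rs))) as [HI|HI]; [left|auto].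
      destruct (H (Ho Hb) rs Hr (fun _ => HI)); auto.
Qed.

End Reduct.

(** * Rule instances and models of the reduct *)

Section Program.

Variables (ord : term_order) (Pi : program) (I : atom_set).

(** The semantic counterpart of [Form]: for a choice rule the head atom must already be in [I]. *)
Definition fires (R : rule variable) (s : variable -> precomputed)
    (a : atom variable) (rs : list precomputed) : Prop :=
  In R (rules Pi) /\ head_lit R = Some a /\
  In rs (vals_tuple (atom_args (subst_atom s a))) /\
  psat I (tau_body ord (map (subst_body_elem s) (body R))) /\
  (head R = HChoice a -> I (PAtom (atom_sym a) rs)).

Definition satisfies_constraints : Prop :=
  forall R s, In R (rules Pi) -> head R = HEmpty ->
  ~ psat I (tau_body ord (map (subst_body_elem s) (body R))).

Definition closed_under_rules : Prop :=
  forall R s a rs, fires R s a rs -> I (PAtom (atom_sym a) rs).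

Definition supported_in (K : atom_set) (s : variable -> precomputed)
    (R : rule variable) : Prop :=
  forall b, In b (positive_body R) -> holds_in I K (subst_atom s b).

Lemma head_lit_subst (s : variable -> precomputed) R a :
  head_lit R = Some a -> head_lit (subst_rule s R) = Some (subst_atom s a).
Proof.
  unfold head_lit; simpl; destruct (head R); simpl; congruence.
Qed.

Lemma choice_subst (s : variable -> precomputed) R a :
  head_lit R = Some a ->
  head (subst_rule s R) = HChoice (subst_atom s a) <-> head R = HChoice a.
Proof.
  unfold head_lit; simpl; destruct (head R); simpl; split; congruence.
Qed.

Lemma supported_in_body K s R :
  psat K (preduct I (tau_body ord (map (subst_body_elem s) (body R)))) <->
  psat I (tau_body ord (map (subst_body_elem s) (body R))) /\
  supported_in K s R.
Proof.
  rewrite psat_preduct_body; unfold supported_in.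
  split; intros [H1 H2]; split; try exact H1.
  - intros b Hb; apply H2; apply in_positive_body in Hb.
    exact (in_map (subst_body_elem s) _ _ Hb).
  - intros a Ha; apply in_map_iff in Ha; destruct Ha as [[n b|c t1 t2] [E Hb]];
      simpl in E; [|discriminate].
    injection E as -> <-; apply H2, in_positive_body, Hb.
Qed.

(** The first two conditions concern [I] alone; [K] enters only in the third, so this is the one to
    check when candidates inside a model are compared. *)
Lemma reduct_model_iff K :
  reduct_model ord Pi I K <->
  satisfies_constraints /\ closed_under_rules /\
  (forall R s a rs, fires R s a rs -> supported_in K s R ->
     K (PAtom (atom_sym a) rs)).
Proof.
  unfold reduct_model, tau; split.
  - intros H.
    assert (HR : forall R s, In R (rules Pi) ->
              psat K (preduct I (tau_rule ord (subst_rule s R)))).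
    { intros R s HR; apply H; eauto. }
    assert (HF : forall R s a rs, fires R s a rs ->
              I (PAtom (atom_sym a) rs) /\
              (supported_in K s R -> K (PAtom (atom_sym a) rs))).
    { intros R s a rs (Hin & Ha & Hr & Hb & Hc).
      specialize (HR R s Hin).
      rewrite (psat_preduct_head_rule ord I K _ (head_lit_subst s _ Ha)) in HR.
      destruct (HR Hb rs Hr) as [H1 H2].
      - rewrite (choice_subst s _ Ha); exact Hc.
      - split; [exact H1|].
        intros Hs; apply H2, supported_in_body; auto. }
    split; [|split].
    + intros R s Hin E; specialize (HR R s Hin).
      unfold tau_rule in HR; simpl in HR; rewrite E in HR.
      exact (proj1 (psat_preduct_neg _ _ _) HR).
    + intros R s a rs Hf; apply (HF R s a rs Hf).
    + intros R s a rs Hf; apply (HF R s a rs Hf).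
  - intros (Hc & Hcl & Hsup) F (R & s & Hin & ->).
    destruct (head_lit R) as [a|] eqn:Ha.
    + apply (psat_preduct_head_rule ord I K _ (head_lit_subst s _ Ha)).
      intros Hb rs Hr Hch; rewrite (choice_subst s _ Ha) in Hch.
      assert (Hf : fires R s a rs) by (repeat split; assumption).
      split; [apply (Hcl _ _ _ _ Hf)|].
      intros Hb'; apply (Hsup _ _ _ _ Hf).
      apply supported_in_body in Hb'; tauto.
    + unfold head_lit in Ha; destruct (head R) eqn:E; try discriminate.
      unfold tau_rule; simpl; rewrite E; simpl.
      apply psat_preduct_neg, Hc; assumption.
Qed.

Lemma in_preds_of_head R a :
  In R (rules Pi) -> head_lit R = Some a -> In (atom_pred a) (preds Pi).
Proof.
  intros HR Ha; apply in_flat_map; exists R; split; [exact HR|].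
  unfold rule_preds; rewrite Ha; simpl; auto.
Qed.

Lemma in_rules_for R p :
  In R (rules_for Pi p) <->
  In R (rules Pi) /\ exists a, head_lit R = Some a /\ atom_pred a = p.
Proof.
  unfold rules_for; rewrite filter_In; destruct (head_lit R) as [a|].
  - destruct (predicate_eq_dec (atom_pred a) p); firstorder congruence.
  - firstorder congruence.
Qed.

(** * Meaning of NC in standard interpretations *)

Section NC.

Variable lvl : symbol -> list precomputed -> numeral.

Local Notation J := (@Build_interp_lvl (standard ord I) lvl).

Definition level_of (a : precomputed_atom) : Z :=
  int_of (lvl (patom_sym a) (patom_args a)).

Lemma assign_instance (s : variable -> precomputed) (rs : list precomputed) :
  exists e : assignment J, prog_val e = s /\
    gen_vals e (fresh_tuple FreshX (length rs)) = rs.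
Proof.
  (* [Inf] and 0 are arbitrary defaults; only program variables and, after the update, the head
     variables matter. *)
  pose (e0 := Build_assignment J
    (fun y => match y with ProgVar x => s x | _ => Inf end)
    (fun _ => overline 0)).
  destruct (@assign_tuple J e0 (fresh_tuple FreshX (length rs)) rs)
    as (e & Ha & Hr).
  - apply fresh_tuple_NoDup; congruence.
  - apply fresh_tuple_length.
  - exists e; split; [|exact Hr].
    rewrite (prog_val_agree_off (e := e0) (ys := map GenVar
               (fresh_tuple FreshX (length rs)))); [reflexivity| |exact Ha].
    intros x Hx; apply in_map_iff in Hx; destruct Hx as [y [E Hy]].
    apply in_fresh_tuple in Hy; destruct Hy as [i ->]; discriminate.
Qed.

Lemma head_vals_length (s : variable -> precomputed) a rs :
  In rs (vals_tuple (atom_args (subst_atom s a))) ->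
  length rs = length (atom_args a).
Proof.
  intros H; apply vals_tuple_length in H; simpl in H.
  rewrite length_map in H; exact H.
Qed.

Lemma sat_Form_fires (e : assignment J) R a :
  In R (rules Pi) -> head_lit R = Some a ->
  let Xs := fresh_tuple FreshX (length (atom_args a)) in
  sat e (Form R Xs) <-> fires R (prog_val e) a (gen_vals e Xs).
Proof.
  intros HR Ha Xs; rewrite (sat_Form e R Xs Ha)
    by (symmetry; apply fresh_tuple_length).
  unfold fires; simpl; tauto.
Qed.

Lemma agree_off_refl ys (e : assignment J) : agree_off ys e e.
Proof. split; reflexivity. Qed.

Lemma model_CompL p :
  model J (CompL Pi p) <->
  forall R s a rs, fires R s a rs -> atom_pred a = p ->
    I (PAtom (atom_sym a) rs).
Proof.
  unfold CompL; rewrite model_FAlls; split.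
  - intros H R s a rs Hf <-.
    pose proof Hf as (HR & Ha & Hr & _).
    destruct (assign_instance s rs) as (e & Hs & HX).
    rewrite (head_vals_length _ _ _ Hr) in HX.
    specialize (H e); simpl in H; rewrite (map_geval_gvars e) in H.
    unfold head_vars in H; simpl in H; rewrite HX in H; apply H; clear H.
    apply sat_FDisj; eexists; split.
    + apply in_map, in_rules_for; split; [exact HR|exists a; split; eauto].
    (* The assignment was chosen to realise [s], so it is its own witness for the existential
       block. *)
    + apply sat_FExs; exists e; split; [apply agree_off_refl|].
      apply sat_Form_fires; [exact HR|exact Ha|].
      rewrite Hs, HX; exact Hf.
  - intros H e; simpl; rewrite (map_geval_gvars e); intros HD.
    apply sat_FDisj in HD; destruct HD as (F & HF & HS).
    apply in_map_iff in HF; destruct HF as (R & <- & HR).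
    apply in_rules_for in HR; destruct HR as (HR & a & Ha & <-).
    apply sat_FExs in HS; destruct HS as (e' & He & HS).
    apply sat_Form_fires in HS; [|exact HR|exact Ha].
    unfold head_vars; simpl.
    rewrite <- (gen_vals_agree_off (fresh_tuple FreshX (length (atom_args a))) He)
      by (intros x; apply local_vars_not_head).
    exact (H _ _ _ _ HS eq_refl).
Qed.

Lemma model_NCompR p :
  model J (NCompR Pi p) <->
  forall rs, length rs = snd p -> I (PAtom (fst p) rs) ->
  exists R s a, fires R s a rs /\ atom_pred a = p /\
    supported_in (fun b => (level_of b < level_of (PAtom (fst p) rs))%Z) s R.
Proof.
  unfold NCompR; rewrite model_FAlls; split.
  - intros H rs Hl HI.
    destruct (assign_instance (fun _ => Inf) rs) as (e & _ & HX).
    rewrite Hl in HX.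
    specialize (H e); simpl in H; rewrite (map_geval_gvars e) in H.
    unfold head_vars in H; rewrite HX in H; specialize (H HI).
    apply sat_FDisj in H; destruct H as (F & HF & HS).
    apply in_map_iff in HF; destruct HF as (R & <- & HR).
    apply in_rules_for in HR; destruct HR as (HR & a & Ha & <-).
    apply sat_FExs in HS; destruct HS as (e' & He & HS & HL).
    apply sat_Form_fires in HS; [|exact HR|exact Ha].
    simpl in HX, HL.
    rewrite <- (gen_vals_agree_off (fresh_tuple FreshX (length (atom_args a))) He)
      in HX by (intros x; apply local_vars_not_head).
    rewrite HX in HS.
    exists R, (prog_val e'), a; split; [exact HS|split; [reflexivity|]].
    intros b Hb; rewrite sat_FConj in HL.
    specialize (HL _ (in_map _ _ _ Hb)); apply sat_lower_level in HL.
    rewrite HX in HL; exact HL.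
  - intros H e; simpl; rewrite (map_geval_gvars e); intros HI.
    destruct (H (gen_vals e (head_vars p))) as (R & s & a & Hf & <- & Hs).
    { unfold gen_vals; rewrite length_map; apply fresh_tuple_length. }
    { exact HI. }
    pose proof Hf as (HR & Ha & _).
    unfold head_vars in *; simpl snd in *; simpl fst in *.
    set (Xs := fresh_tuple FreshX (length (atom_args a))) in *.
    apply sat_FDisj; eexists; split.
    { apply in_map, in_rules_for; split; [exact HR|exists a; split; eauto]. }
    apply sat_FExs.
    (* Copying [s] onto all program variables could violate [agree_off]. Restricting it to
       [local_vars] suffices because all variables of the rule lie there. *)
    set (e' := Build_assignment J
      (fun y => match y with
                | ProgVar x =>
                    if in_dec var_eq_dec (GenVar (ProgVar x)) (local_vars R Xs)
                    then s x else gen_val e y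
                | _ => gen_val e y
                end)
      (int_val e)).
    assert (He : agree_off (local_vars R Xs) e e').
    { split; [|reflexivity]; intros [x|i|i|i] Hx; simpl; try reflexivity.
      destruct (in_dec _ _ _); tauto. }
    assert (Hv : forall x, In x (rule_vars R) -> prog_val e' x = s x).
    { intros x Hx; unfold prog_val; simpl.
      destruct (in_dec _ _ _) as [|Hn]; [reflexivity|].
      destruct Hn; exact (rule_vars_local x R Ha eq_refl Hx). }
    assert (HX : gen_vals e' Xs = gen_vals e Xs).
    { apply (gen_vals_agree_off Xs He); intros x; apply local_vars_not_head. }
    clearbody e'.
    destruct (subst_rule_parts_ext (prog_val e') s R Hv) as (E1 & E2 & E3).
    exists e'; split; [exact He|split].
    + apply sat_Form_fires; [exact HR|exact Ha|].
      fold Xs; rewrite HX; destruct Hf as (_ & _ & Hr & Hb & Hc).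
      split; [exact HR|split; [exact Ha|]].
      rewrite (E1 _ Ha), E2; auto.
    + apply sat_FConj; intros F HF; apply in_map_iff in HF.
      destruct HF as (b & <- & Hb); apply sat_lower_level.
      fold Xs; rewrite HX, (E3 _ Hb); exact (Hs _ Hb).
Qed.

Lemma model_Cons : model J (Cons Pi) <-> satisfies_constraints.
Proof.
  unfold Cons, constraints; rewrite model_FConj; split.
  - intros H R s HR HE.
    destruct (assign_instance s []) as (e & Hs & _).
    assert (HM : model J (FAlls (fv (tauB (body R))) (FNeg (tauB (body R))))).
    { apply H, in_map_iff; exists R; split; [reflexivity|].
      apply filter_In; rewrite HE; auto. }
    rewrite model_FAlls in HM; specialize (HM e); simpl in HM.
    rewrite sat_tauB, Hs in HM; exact HM.
  - intros H F HF; apply in_map_iff in HF; destruct HF as (R & <- & HR).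
    apply filter_In in HR; destruct HR as [HR HE].
    destruct (head R) eqn:E; try discriminate.
    rewrite model_FAlls; intros e; simpl; rewrite sat_tauB.
    exact (H R _ HR E).
Qed.

Lemma model_NatLvl :
  model J (NatLvl Pi) <->
  forall a, In (patom_pred a) (preds Pi) -> (0 <= level_of a)%Z.
Proof.
  assert (Hge : forall (e : assignment J) p Xs,
    sat e (ICmp Ge (ILvl p (gvars Xs)) (IZ 0)) <->
    (0 <= level_of (PAtom p (gen_vals e Xs)))%Z).
  { intros e p Xs; simpl; rewrite (map_geval_gvars e); unfold level_of; simpl.
    destruct (lvl p _) as [k]; apply (tle_num ord 0 k). }
  unfold NatLvl; rewrite model_FConj; split.
  - intros H [p rs] Ha.
    destruct (assign_instance (fun _ => Inf) rs) as (e & _ & HX).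
    specialize (H _ (in_map _ _ _ Ha)); rewrite model_FAlls in H.
    specialize (H e); apply Hge in H; unfold head_vars in H; simpl in H.
    rewrite HX in H; exact H.
  - intros H F HF; apply in_map_iff in HF; destruct HF as (p & <- & Hp).
    rewrite model_FAlls; intros e; apply Hge, H; unfold patom_pred; simpl.
    unfold gen_vals, head_vars; rewrite length_map, fresh_tuple_length.
    destruct p; exact Hp.
Qed.

Lemma model_NC :
  over_program Pi I ->
  model J (NC Pi) <->
  (forall a, In (patom_pred a) (preds Pi) -> (0 <= level_of a)%Z) /\
  satisfies_constraints /\ closed_under_rules /\
  (forall c, I c -> exists R s a rs,
     fires R s a rs /\ c = PAtom (atom_sym a) rs /\
     supported_in (fun b => (level_of b < level_of c)%Z) s R).
Proof.
  intros HI; unfold NC; rewrite model_FConj.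
  rewrite <- model_NatLvl, <- model_Cons.
  assert (HCN : model J (FConj (map (fun p => FAnd (CompL Pi p) (NCompR Pi p))
                                  (preds Pi))) <->
    forall p, In p (preds Pi) -> model J (CompL Pi p) /\ model J (NCompR Pi p)).
  { rewrite model_FConj; split.
    - intros H p Hp; apply model_FAnd, H.
      exact (in_map (fun p => FAnd (CompL Pi p) (NCompR Pi p)) _ _ Hp).
    - intros H F HF; apply in_map_iff in HF; destruct HF as (p & <- & Hp).
      apply model_FAnd, H, Hp. }
  split.
  - intros H.
    assert (H3 := proj1 HCN (H _ (or_intror (or_intror (or_introl eq_refl))))).
    split; [apply H; simpl; auto|split; [apply H; simpl; auto|split]].
    + intros R s a rs Hf; pose proof Hf as (HR & Ha & _).
      destruct (H3 _ (in_preds_of_head _ HR Ha)) as [HC _].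
      exact (proj1 (model_CompL _) HC _ _ _ _ Hf eq_refl).
    (* [NCompR] is available only for predicates of the program; [over_program] supplies this for
       every atom of [I]. *)
    + intros [p rs] Hc; destruct (H3 _ (HI _ Hc)) as [_ HN].
      destruct (proj1 (model_NCompR _) HN rs eq_refl Hc)
        as (R & s & a & Hf & Hp & Hs).
      injection Hp as Hp _.
      exists R, s, a, rs; rewrite Hp; auto.
  - intros (H1 & H2 & H3 & H4) F [<-|[<-|[<-|[]]]]; [exact H1|exact H2|].
    apply HCN; intros p Hp; split.
    + apply model_CompL; intros; eapply H3; eassumption.
    + apply model_NCompR; intros rs Hl Hc.
      destruct (H4 _ Hc) as (R & s & a & rs' & Hf & E & Hs).
      injection E as E <-; exists R, s, a; split; [exact Hf|split; [|exact Hs]].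
      destruct Hf as (_ & _ & Hr & _); apply head_vals_length in Hr.
      destruct p as [p n]; unfold atom_pred; simpl in *; congruence.
Qed.

End NC.

(** * Stages of derivation *)

(** Iterates, starting from the empty set, of the derivation operator attached to the reduct. The
    conjunct [I c] keeps every stage inside [I] without appeal to closure under rules. *)
Fixpoint stage (n : nat) (c : precomputed_atom) : Prop :=
  match n with
  | 0 => False
  | S n => I c /\ exists R s a rs,
      fires R s a rs /\ c = PAtom (atom_sym a) rs /\ supported_in (stage n) s R
  end.

Lemma supported_in_mono (K K' : atom_set) s R :
  (forall c, K c -> K' c) -> supported_in K s R -> supported_in K' s R.
Proof.
  intros HK H b Hb; destruct (H b Hb) as (rs & Hr & H1 & H2); exists rs; auto.
Qed.

Lemma stage_mono m n c : m <= n -> stage m c -> stage n c.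
Proof.
  revert n c; induction m as [|m IH]; intros [|n] c Hmn; simpl; try tauto;
    try lia.
  intros (HI & R & s & a & rs & Hf & E & Hs); split; [exact HI|].
  exists R, s, a, rs; repeat (split; [assumption|]).
  eapply supported_in_mono; [|exact Hs]; intros d; apply IH; lia.
Qed.

Lemma stage_subset n c : stage n c -> I c.
Proof. destruct n; simpl; tauto. Qed.

(* A body has finitely many positive literals, so one finite stage serves
   all of them. *)
Lemma supported_in_stage s R :
  supported_in (fun c => exists n, stage n c) s R ->
  exists n, supported_in (stage n) s R.
Proof.
  unfold supported_in; induction (positive_body R) as [|b l IH]; intros H.
  - exists 0; intros b [].
  - destruct IH as [n Hn]; [intros d Hd; apply H; simpl; auto|].
    destruct (H b (or_introl eq_refl)) as (rs & Hr & HI & m & Hm).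
    exists (Nat.max m n); intros d [<-|Hd].
    + exists rs; repeat (split; [assumption|]).
      apply (@stage_mono m); [lia|exact Hm].
    + destruct (Hn d Hd) as (rs' & Hr' & HI' & Hn').
      exists rs'; repeat (split; [assumption|]).
      apply (@stage_mono n); [lia|exact Hn'].
Qed.

(** The union of the stages lies in [I] and is a model of the reduct, so minimality makes it contain
    [I]. *)
Lemma stable_model_stage c : stable_model ord Pi I -> I c -> exists n, stage n c.
Proof.
  intros [Hm Hmin]; apply (Hmin (fun c => exists n, stage n c)).
  - intros d [n Hn]; exact (stage_subset _ _ Hn).
  - apply reduct_model_iff in Hm; destruct Hm as (Hc & Hcl & _).
    apply reduct_model_iff; split; [exact Hc|split; [exact Hcl|]].
    intros R s a rs Hf Hs; apply supported_in_stage in Hs.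
    destruct Hs as [n Hs]; exists (S n); split; [exact (Hcl _ _ _ _ Hf)|].
    exists R, s, a, rs; auto.
Qed.

(** Defined by [epsilon], hence total: an atom that is never derived receives an unspecified natural
    number, which still gives a nonnegative level. *)
Definition least_stage (c : precomputed_atom) : nat :=
  epsilon (inhabits 0) (fun n => stage n c /\ forall m, stage m c -> n <= m).

Lemma least_stage_spec n c :
  stage n c -> stage (least_stage c) c /\ least_stage c <= n.
Proof.
  intros Hn.
  assert (H : exists n, stage n c /\ forall m, stage m c -> n <= m).
  { induction n as [n IH] using (well_founded_induction lt_wf).
    destruct (classic (exists m, m < n /\ stage m c)) as [(m & Hm & H)|H].
    - exact (IH m Hm H).
    - exists n; split; [exact Hn|]; intros m Hm.
      destruct (Nat.le_gt_cases n m); [assumption|].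
      destruct H; eauto. }
  destruct (epsilon_spec (inhabits 0) _ H) as [H1 H2].
  split; [exact H1|apply H2, Hn].
Qed.

End Program.

(** * Levels from stages, and minimality by induction on levels *)

Theorem mainTheorem3 (ord : term_order) (Pi : program) (I : atom_set)
    (HI : over_program Pi I) :
  stable_model ord Pi I <->
  exists J : interp_lvl, reduct J = standard ord I /\ model J (NC Pi).
Proof.
  split.
  - intros HS.
    pose (lvl p rs :=
      overline (Z.of_nat (least_stage ord Pi I (PAtom p rs)))).
    assert (Hlvl : forall c, level_of lvl c =
              Z.of_nat (least_stage ord Pi I c)) by (intros []; reflexivity).
    exists (@Build_interp_lvl (standard ord I) lvl); split; [reflexivity|].
    apply (model_NC ord lvl HI).
    pose proof (proj1 (reduct_model_iff ord Pi I I) (proj1 HS))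
      as (Hc & Hcl & _).
    split; [intros a _; rewrite Hlvl; lia|].
    split; [exact Hc|split; [exact Hcl|]].
    intros c Hc'; destruct (stable_model_stage c HS Hc') as [n Hn].
    destruct (least_stage_spec _ _ _ _ _ Hn) as [Hl _].
    (* Stage 0 is empty, so the least stage is some [S m]; the supporting atoms lie in stage [m],
       and their least stages are at most [m]. *)
    destruct (least_stage ord Pi I c) as [|m] eqn:Em; [destruct Hl|].
    destruct Hl as (_ & R & s & a & rs & Hf & E & Hs).
    exists R, s, a, rs; split; [exact Hf|split; [exact E|]].
    eapply supported_in_mono; [|exact Hs]; intros b Hb.
    apply least_stage_spec in Hb; rewrite !Hlvl, Em; lia.
  - intros ([Jr lvl] & HJ & HM); simpl in HJ; subst Jr.
    apply (model_NC ord lvl HI) in HM; destruct HM as (Hn & Hc & Hcl & Hsup).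
    split.
    + apply reduct_model_iff; split; [exact Hc|split; [exact Hcl|]].
      intros R s a rs Hf _; exact (Hcl _ _ _ _ Hf).
    + intros I' Hsub HI'; apply reduct_model_iff in HI'.
      destruct HI' as (_ & _ & HI').
      (* Levels are integers, so the induction runs on [Z.to_nat] of the level. *)
      intros c; remember (Z.to_nat (level_of lvl c)) as n eqn:En.
      revert c En; induction n as [n IH] using (well_founded_induction lt_wf).
      intros c En HIc.
      destruct (Hsup c HIc) as (R & s & a & rs & Hf & -> & Hs).
      apply (HI' R s a rs Hf); intros b Hb.
      destruct (Hs b Hb) as (rs' & Hr' & HIb & Hlt).
      exists rs'; repeat (split; [assumption|]).
      refine (IH _ _ _ eq_refl HIb).
      (* Nonnegativity of both levels makes [Z.to_nat] preserve the strict inequality; it applies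
         because atoms of [I] are over the program. *)
      pose proof (Hn _ (HI _ HIb)); pose proof (Hn _ (HI _ HIc)); lia.
Qed.
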